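(* Let $X$ be a simply-connected $H$-complex, let $Y\to X$ be an $H$-equivariant immersion, and let $P\to Y$ be an essential path. Suppose that $P\to Y\to X$ is a closed path that is simple in the sense that it embeds except at its endpoints. Then $Y\to X$ factors as a composition $Y\to Z\to X$ of $H$-equivariant maps where $Y\to Z$ is $\pi_1$-surjective, $Z\to X$ is an immersion, and the path $P\to Y\to Z$ is closed and null-homotopic. Moreover $Z$ can be chosen such that: (1) if $Y$ is connected then $Z$ is connected; (2) if $Y$ is $H$-cocompact then $Z$ is $H$-cocompact; (3) $|\mathrm{bnd}(H,Z)\cup\mathrm{isolated}(H,Z)|\le|\mathrm{bnd}(H,Y)\cup\mathrm{isolated}(H,Y)|$.
   Context: Complexes are combinatorial 2-complexes, maps are combinatorial; an $H$-complex has a cellular $H$-action without inversions, and is $H$-cocompact if it has finitely many $H$-orbits of cells. The link of a $0$-cell $x$ is the graph with a vertex for each end of a $1$-cell at $x$ and an edge for each corner of a $2$-cell at $x$. A map is an immersion if it is locally injective, equivalently the induced maps on links of $0$-cells are embeddings. A path is a combinatorial map $P\to Y$ from a subdivided interval (or a point); it is closed if its endpoints map to the same $0$-cell. A path $P\to Y$ is essential if its lift $P\to\widetilde Y$ to the universal cover is not closed. $\mathrm{bnd}(H,Y)$ is the set of $H$-orbits of $0$-cells $y$ whose link is a single vertex or has a vertex of valence one; $\mathrm{isolated}(H,Y)$ is the set of $H$-orbits of $0$-cells whose link has at least one vertex of valence zero. *)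

(* Defs.v *)
From Stdlib Require Import List Arith Relations.
Import ListNotations.
Set Implicit Arguments.

Record grp := Grp {
  gT :> Type;
  gmul : gT -> gT -> gT;
  gone : gT;
  ginv : gT -> gT;
  gmulA : forall a b c, gmul a (gmul b c) = gmul (gmul a b) c;
  gmul1 : forall a, gmul gone a = a;
  gmulV : forall a, gmul (ginv a) a = gone
}.

(** * Combinatorial 2-complexes.
  [cV] : 0-cells.  [cD] : oriented 1-cells (darts = ends of 1-cells);
  [src d] is the 0-cell at which the end [d] lies, [rev d] the other
  orientation (the other end) of the same 1-cell.
  [cF] : 2-cells.  [cC] : positions on boundaries of 2-cells, in both
  orientations: a 2-cell whose boundary circle is subdivided into n >= 1
  edges has 2n positions. [cdart c] is the dart traversed at position [c],
  [cnext c] the next position in the same orientation, [cflip c] the same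
  position traversed in the opposite orientation.  So the attaching map of
  every 2-cell is a closed combinatorial path in the 1-skeleton. *)
Record complex := Complex {
  cV : Type; cD : Type; cF : Type; cC : Type;
  src : cD -> cV;
  rev : cD -> cD;
  rev_inv : forall d, rev (rev d) = d;
  rev_nofix : forall d, rev d <> d;
  cface : cC -> cF;
  cdart : cC -> cD;
  cnext : cC -> cC;
  cflip : cC -> cC;
  cnext_src : forall c, src (cdart (cnext c)) = src (rev (cdart c));
  cnext_face : forall c, cface (cnext c) = cface c;
  cflip_inv : forall c, cflip (cflip c) = c;
  cflip_face : forall c, cface (cflip c) = cface c;
  cflip_dart : forall c, cdart (cflip c) = rev (cdart c);
  cflip_next : forall c, cnext (cflip (cnext c)) = cflip c;
  cycle_finite : forall c, exists k, 0 < k /\ Nat.iter k cnext c = c;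
  orient_disj : forall c k, Nat.iter k cnext c <> cflip c;
  face_conn : forall c c', cface c = cface c' ->
     exists k, c' = Nat.iter k cnext c \/ c' = Nat.iter k cnext (cflip c);
  face_nonempty : forall f, exists c, cface c = f
}.

Arguments src {_} _.
Arguments rev {_} _.
Arguments cface {_} _.
Arguments cdart {_} _.
Arguments cnext {_} _.
Arguments cflip {_} _.

Definition tgt {K : complex} (d : cD K) : cV K := src (rev d).

(** * Combinatorial maps: cells go homeomorphically onto cells of the same
    dimension (on 2-cells: the boundary positions correspond bijectively). *)
Record hom (K L : complex) := Hom {
  fV : cV K -> cV L;
  fD : cD K -> cD L;
  fF : cF K -> cF L;
  fC : cC K -> cC L;
  f_src : forall d, src (fD d) = fV (src d);
  f_rev : forall d, fD (rev d) = rev (fD d);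
  f_face : forall c, cface (fC c) = fF (cface c);
  f_dart : forall c, cdart (fC c) = fD (cdart c);
  f_next : forall c, fC (cnext c) = cnext (fC c);
  f_flip : forall c, fC (cflip c) = cflip (fC c);
  f_face_inj : forall c1 c2, cface c1 = cface c2 -> fC c1 = fC c2 -> c1 = c2
}.

Arguments fV {_ _} _ _.
Arguments fD {_ _} _ _.
Arguments fF {_ _} _ _.
Arguments fC {_ _} _ _.

(** * Links.  The link of a 0-cell x has a vertex for each dart d with
    [src d = x] and an edge (corner) for each position c with
    [tgt (cdart c) = x], where c and [cflip (cnext c)] give the same corner;
    this corner joins the link vertices [rev (cdart c)] and [cdart (cnext c)]. *)
Definition same_corner {K : complex} (c c' : cC K) : Prop :=
  c' = c \/ c' = cflip (cnext c).

(** A map is an immersion iff the induced maps on links of 0-cells are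
    embeddings (injective on link vertices and on link edges). *)
Definition immersion {K L : complex} (f : hom K L) : Prop :=
  (forall d1 d2 : cD K, src d1 = src d2 -> fD f d1 = fD f d2 -> d1 = d2) /\
  (forall c1 c2 : cC K, tgt (cdart c1) = tgt (cdart c2) ->
      same_corner (fC f c1) (fC f c2) -> same_corner c1 c2).

(** Valence of the link vertex d (in the link of [src d]): the
    corner-ends at d correspond bijectively to the positions c with
    [cdart (cnext c) = d]. *)
Definition valence_zero {K : complex} (d : cD K) : Prop :=
  forall c : cC K, cdart (cnext c) <> d.
Definition valence_one {K : complex} (d : cD K) : Prop :=
  exists c : cC K, cdart (cnext c) = d /\
    forall c', cdart (cnext c') = d -> c' = c.

Definition link_single {K : complex} (x : cV K) : Prop :=
  (exists d : cD K, src d = x /\ forall d', src d' = x -> d' = d) /\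
  (forall c : cC K, tgt (cdart c) <> x).

Definition is_bnd {K : complex} (x : cV K) : Prop :=
  link_single x \/ exists d : cD K, src d = x /\ valence_one d.
Definition is_isolated {K : complex} (x : cV K) : Prop :=
  exists d : cD K, src d = x /\ valence_zero d.
Definition bnd_or_isolated {K : complex} (x : cV K) : Prop :=
  is_bnd x \/ is_isolated x.

Fixpoint chain {K : complex} (v : cV K) (l : list (cD K)) : Prop :=
  match l with
  | nil => True
  | d :: l' => src d = v /\ chain (tgt d) l'
  end.

Fixpoint pend {K : complex} (v : cV K) (l : list (cD K)) : cV K :=
  match l with
  | nil => v
  | d :: l' => pend (tgt d) l'
  end.

Record path (K : complex) := Path { pstart : cV K; pdarts : list (cD K) }.
Arguments pstart {_} _.
Arguments pdarts {_} _.
Arguments Path {K} _ _.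

Definition valid_path {K : complex} (P : path K) : Prop := chain (pstart P) (pdarts P).
Definition closed_path {K : complex} (P : path K) : Prop :=
  pend (pstart P) (pdarts P) = pstart P.

Definition map_path {K L : complex} (f : hom K L) (P : path K) : path L :=
  Path (fV f (pstart P)) (map (fD f) (pdarts P)).

(** The boundary word of length k read from position c (a power of the
    boundary of the 2-cell when [Nat.iter k cnext c = c]). *)
Definition bword {K : complex} (c : cC K) (k : nat) : list (cD K) :=
  map (fun i => cdart (Nat.iter i cnext c)) (seq 0 k).

Definition hstep {K : complex} (v : cV K) (l l' : list (cD K)) : Prop :=
  exists l1 l2, l' = l1 ++ l2 /\
   ((exists d, src d = pend v l1 /\ l = l1 ++ d :: rev d :: l2) \/
    (exists c k, 0 < k /\ Nat.iter k cnext c = c /\ src (cdart c) = pend v l1 /\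
       l = l1 ++ bword c k ++ l2)).

Definition homotopic {K : complex} (v : cV K) : relation (list (cD K)) :=
  clos_refl_sym_trans _ (hstep v).

Definition nullhomotopic {K : complex} (P : path K) : Prop :=
  homotopic (pstart P) (pdarts P) nil.

(** Essential: the lift to the universal cover is not closed, i.e. the
    path is not (closed and null-homotopic). *)
Definition essential {K : complex} (P : path K) : Prop :=
  ~ (closed_path P /\ nullhomotopic P).

Definition simple_closed {K : complex} (P : path K) : Prop :=
  (forall i j, i < j < length (pdarts P) ->
     pend (pstart P) (firstn i (pdarts P)) <> pend (pstart P) (firstn j (pdarts P))) /\
  (forall i j di dj, i < j -> nth_error (pdarts P) i = Some di ->
     nth_error (pdarts P) j = Some dj -> di <> dj /\ di <> rev dj).

Definition connected (K : complex) : Prop :=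
  forall u v : cV K, exists l, chain u l /\ pend u l = v.

Definition simply_connected (K : complex) : Prop :=
  inhabited (cV K) /\ connected K /\
  forall (v : cV K) l, chain v l -> pend v l = v -> homotopic v l nil.

Definition pi1_surj {K L : complex} (f : hom K L) : Prop :=
  forall (y : cV K) (m : list (cD L)), chain (fV f y) m -> pend (fV f y) m = fV f y ->
    exists l, chain y l /\ pend y l = y /\ homotopic (fV f y) (map (fD f) l) m.

Record Hcomplex (H : grp) := HComplex {
  hcx :> complex;
  aV : H -> cV hcx -> cV hcx;
  aD : H -> cD hcx -> cD hcx;
  aF : H -> cF hcx -> cF hcx;
  aC : H -> cC hcx -> cC hcx;
  aV1 : forall x, aV (gone H) x = x;
  aD1 : forall x, aD (gone H) x = x;
  aF1 : forall x, aF (gone H) x = x;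
  aC1 : forall x, aC (gone H) x = x;
  aVM : forall (g h : H) x, aV (gmul H g h) x = aV g (aV h x);
  aDM : forall (g h : H) x, aD (gmul H g h) x = aD g (aD h x);
  aFM : forall (g h : H) x, aF (gmul H g h) x = aF g (aF h x);
  aCM : forall (g h : H) x, aC (gmul H g h) x = aC g (aC h x);
  a_src : forall h d, src (aD h d) = aV h (src d);
  a_rev : forall h d, aD h (rev d) = rev (aD h d);
  a_face : forall h c, cface (aC h c) = aF h (cface c);
  a_dart : forall h c, cdart (aC h c) = aD h (cdart c);
  a_next : forall h c, aC h (cnext c) = cnext (aC h c);
  a_flip : forall h c, aC h (cflip c) = cflip (aC h c);
  no_inversion : forall h d, aD h d <> rev d
}.

Arguments aV {_} _ _ _.
Arguments aD {_} _ _ _.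
Arguments aF {_} _ _ _.
Arguments aC {_} _ _ _.

Definition equivariant {H : grp} {K L : Hcomplex H} (f : hom K L) : Prop :=
  (forall h x, fV f (aV K h x) = aV L h (fV f x)) /\
  (forall h x, fD f (aD K h x) = aD L h (fD f x)) /\
  (forall h x, fF f (aF K h x) = aF L h (fF f x)) /\
  (forall h x, fC f (aC K h x) = aC L h (fC f x)).

Definition cocompact {H : grp} (K : Hcomplex H) : Prop :=
  (exists r : list (cV K), forall x, exists h y, In y r /\ x = aV K h y) /\
  (exists r : list (cD K), forall x, exists h y, In y r /\ x = aD K h y) /\
  (exists r : list (cF K), forall x, exists h y, In y r /\ x = aF K h y).

Definition orbV {H : grp} (K : Hcomplex H) (x y : cV K) : Prop :=
  exists h, y = aV K h x.

(** |bnd(H,Z) u isolated(H,Z)| <= |bnd(H,Y) u isolated(H,Y)| as sets of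
    H-orbits of 0-cells: an injection between the sets of orbits. *)
Definition orbit_card_le {H : grp} (Z Y : Hcomplex H) : Prop :=
  exists g : {z : cV Z | bnd_or_isolated z} -> cV Y,
    (forall z, bnd_or_isolated (g z)) /\
    (forall z1 z2, orbV Z (proj1_sig z1) (proj1_sig z2) -> orbV Y (g z1) (g z2)) /\
    (forall z1 z2, orbV Y (g z1) (g z2) -> orbV Z (proj1_sig z1) (proj1_sig z2)).

Definition factors {K L M : complex} (g : hom K L) (k : hom L M) (f : hom K M) : Prop :=
  (forall x, fV k (fV g x) = fV f x) /\ (forall x, fD k (fD g x) = fD f x) /\
  (forall x, fF k (fF g x) = fF f x) /\ (forall x, fC k (fC g x) = fC f x).

(* Main.v *)
(** An immersion [Z -> X] is determined by the 0-cells of [Z] together with a partial action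
    on them of the words in the darts of [X]; so complexes immersed in [X] are handled as
    subsets [DP], [CP] of darts and positions in one fixed action.

    The null-homotopy of the image of [P] in [X] uses finitely many 2-cells.  Let [Z0] be the
    complex freely generated by [Y], by these 2-cells and their [H]-translates, and by all
    darts of [X] at all 0-cells: its 0-cells are classes of pairs (0-cell of [Y], path in [X]),
    and outside [Y] and the attached 2-cells its 1-skeleton consists of trees.  Hence
    [Y -> Z0] is surjective on fundamental groups and [P] is null-homotopic in [Z0].

    Now delete, repeatedly, all 1-cells not coming from [Y] that are traversed at most once by
    2-cells, together with the 2-cells that traverse them.  Each deletion is injective on
    fundamental groups, so both properties persist, and after the first deletion only finitely
    many orbits of 1-cells outside [Y] are left, so the process stops.  Finally keep the
    components that meet the image of [Y].  A dart of the resulting [Z] of valence at most one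
    comes from [Y], where its valence is at most one as well; this gives (3). *)

From Stdlib Require Import List Arith Relations Lia Classical ClassicalEpsilon.
From Stdlib Require Import FunctionalExtensionality PropExtensionality ProofIrrelevance.
Require Import Defs.
Import ListNotations.
Set Implicit Arguments.

(** * Boundary words *)

(** The obstacle is that deletions must respect [H]: whole orbits of 1-cells vanish at once, and one
    2-cell may lose several sides, so it cannot simply be collapsed through one free side at a time.
    Injectivity is therefore obtained algebraically. Every 1-cell receives a holonomy, a loop at a
    base point of the deleted complex. In each 2-cell about to vanish one deleted side is selected;
    as the 2-cells traverse that side only once, its holonomy can be prescribed so that the boundary
    product becomes trivial, and all other deleted sides get the trivial loop. Holonomy then
    respects homotopies of the large complex and, up to tree paths, fixes the words of the small
    one. These choices need not be equivariant; only the deleted set has to be [H]-invariant. Words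
    of [Y] survive every deletion, so a homotopy in the large complex from a surviving loop to a
    loop of [Y] descends to the small one. *)

Lemma bword_S (X : complex) (c : cC X) k :
  bword c (S k) = cdart c :: bword (cnext c) k.
Proof.
  unfold bword. simpl. f_equal. rewrite <- seq_shift, map_map.
  apply map_ext. intro i. now rewrite Nat.iter_succ_r.
Qed.

Lemma bword_add (X : complex) (c : cC X) j k :
  bword c (j + k) = bword c j ++ bword (Nat.iter j cnext c) k.
Proof.
  revert c; induction j as [|j IH]; intro c; [reflexivity|].
  change (S j + k) with (S (j + k)). rewrite !bword_S, IH. simpl.
  now rewrite <- Nat.iter_succ, Nat.iter_succ_r.
Qed.

Lemma map_bword (K L : complex) (f : hom K L) c k :
  map (fD f) (bword c k) = bword (fC f c) k.
Proof.
  revert c; induction k as [|k IH]; intro c; [reflexivity|].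
  now rewrite !bword_S, <- f_next, <- IH, f_dart.
Qed.

Lemma iter_hom (K L : complex) (f : hom K L) c k :
  fC f (Nat.iter k cnext c) = Nat.iter k cnext (fC f c).
Proof. induction k as [|k IH]; simpl; [reflexivity|]. now rewrite f_next, IH. Qed.

Lemma iter_face (X : complex) (c : cC X) k : cface (Nat.iter k cnext c) = cface c.
Proof. induction k as [|k IH]; simpl; [reflexivity|]. now rewrite cnext_face. Qed.

(** Both positions lie on finite cycles. A common multiple of the two periods returns each to
    itself, and after one step the cycles agree. *)
Lemma cnext_inj (X : complex) (c c' : cC X) : cnext c = cnext c' -> c = c'.
Proof.
  intro E. destruct (cycle_finite _ c) as (k & Hk & Ek).
  destruct (cycle_finite _ c') as (k' & Hk' & Ek').
  assert (P : forall m (x : cC X) j, Nat.iter j cnext x = x ->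
                 Nat.iter (m * j) cnext x = x).
  { induction m as [|m IH]; intros x j Ej; simpl; [reflexivity|].
    now rewrite Nat.iter_add, IH. }
  rewrite <- (P k' c k Ek), <- (P k c' k' Ek'), (Nat.mul_comm k k').
  destruct (k' * k) as [|n] eqn:En; [nia|].
  now rewrite !Nat.iter_succ_r, E.
Qed.

Lemma iter_cnext_inj (X : complex) k (c c' : cC X) :
  Nat.iter k cnext c = Nat.iter k cnext c' -> c = c'.
Proof. induction k as [|k IH]; simpl; [easy|]. intro E. now apply IH, cnext_inj. Qed.

(** After [k] steps and a reversal, [k] further steps retrace the way. *)
Lemma iter_flip_iter (X : complex) k (c : cC X) :
  Nat.iter k cnext (cflip (Nat.iter k cnext c)) = cflip c.
Proof.
  revert c; induction k as [|k IH]; intro c; [reflexivity|].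
  rewrite Nat.iter_succ_r. change (Nat.iter (S k) cnext c) with (cnext (Nat.iter k cnext c)). rewrite cflip_next. apply IH.
Qed.

Lemma cflip_inj (X : complex) (c c' : cC X) : cflip c = cflip c' -> c = c'.
Proof. intro E. now rewrite <- (cflip_inv _ c), E, cflip_inv. Qed.

Lemma iter_flip_period (X : complex) k (c : cC X) :
  Nat.iter k cnext (cflip c) = cflip c -> Nat.iter k cnext c = c.
Proof.
  intro E. apply cflip_inj, (@iter_cnext_inj X k). now rewrite E, iter_flip_iter.
Qed.

Lemma least_period (X : complex) (c : cC X) :
  exists k, Nat.iter (S k) cnext c = c /\ forall j, 0 < j <= k -> Nat.iter j cnext c <> c.
Proof.
  destruct (cycle_finite _ c) as (n & Hn & En).
  induction n as [n IH] using (well_founded_induction lt_wf).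
  destruct (classic (exists j, 0 < j < n /\ Nat.iter j cnext c = c)) as [(j & Hj & Ej)|Hmin].
  - now apply (IH j).
  - destruct n as [|k]; [lia|]. exists k. split; [easy|].
    intros j Hj Ej. apply Hmin. exists j. split; [lia|easy].
Qed.

Lemma cflip_tgt (X : complex) (c : cC X) : src (cdart (cflip c)) = tgt (cdart c).
Proof. unfold tgt. now rewrite cflip_dart. Qed.

(** * Endpoints and inverses of words *)

Lemma pend_app (X : complex) (v : cV X) l1 l2 :
  pend v (l1 ++ l2) = pend (pend v l1) l2.
Proof. revert v; induction l1 as [|d l IH]; intro v; simpl; auto. Qed.

Lemma chain_app (X : complex) (v : cV X) l1 l2 :
  chain v (l1 ++ l2) <-> chain v l1 /\ chain (pend v l1) l2.
Proof. revert v; induction l1 as [|d l IH]; intro v; simpl; [tauto|]. rewrite IH. tauto. Qed.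

Lemma chain_bword (X : complex) (c : cC X) k :
  chain (src (cdart c)) (bword c k) /\
  pend (src (cdart c)) (bword c k) = src (cdart (Nat.iter k cnext c)).
Proof.
  revert c; induction k as [|k IH]; intro c; [easy|].
  rewrite bword_S, Nat.iter_succ_r. simpl. unfold tgt.
  rewrite <- cnext_src. destruct (IH (cnext c)). tauto.
Qed.

Lemma tgt_rev (X : complex) (d : cD X) : tgt (rev d) = src d.
Proof. unfold tgt. now rewrite rev_inv. Qed.

Definition winv {X : complex} (l : list (cD X)) : list (cD X) := List.rev (map rev l).

Lemma winv_cons (X : complex) (d : cD X) l : winv (d :: l) = winv l ++ [rev d].
Proof. reflexivity. Qed.

Lemma winv_app (X : complex) (l1 l2 : list (cD X)) :
  winv (l1 ++ l2) = winv l2 ++ winv l1.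
Proof. unfold winv. now rewrite map_app, rev_app_distr. Qed.

Lemma winv_invol (X : complex) (l : list (cD X)) : winv (winv l) = l.
Proof.
  induction l as [|d l IH]; [reflexivity|].
  rewrite winv_cons, winv_app, IH. unfold winv; simpl. now rewrite rev_inv.
Qed.

(** Backward reading starts at the flip of the last position, which for a word of length [S j] is
    [j] steps after [c]. *)
Lemma winv_bword (X : complex) (c : cC X) j :
  winv (bword c (S j)) = bword (cflip (Nat.iter j cnext c)) (S j).
Proof.
  revert c; induction j as [|j IH]; intro c.
  - unfold winv, bword; simpl. now rewrite cflip_dart.
  - rewrite bword_S, winv_cons, IH, <- Nat.iter_succ_r.
    rewrite <- (Nat.add_1_r (S j)), bword_add, iter_flip_iter.
    unfold bword at 3. simpl map. now rewrite cflip_dart.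
Qed.

(** * Immersed complexes as partial actions of words *)

Section Walks.
Variable X : complex.
Variable V : Type.
Variable phi : V -> cV X.
Variable T : V -> cD X -> V.
(** [T] is total, so its value at a dart that does not start over [phi v] carries no geometric
    meaning; the predicates [DP] below keep such pairs out. *)
Hypothesis T_rev : forall v d, phi v = src d -> T (T v d) (rev d) = v.

Definition walk (v : V) (l : list (cD X)) : V := fold_left T l v.

Lemma walk_app v l1 l2 : walk v (l1 ++ l2) = walk (walk v l1) l2.
Proof. apply fold_left_app. Qed.

Lemma walk_cons v d l : walk v (d :: l) = walk (T v d) l.
Proof. reflexivity. Qed.

(** A pair [(v, c)] stands for the position at [v] lying over [c]. *)
Definition pos : Type := V * cC X.
Definition pnext (p : pos) : pos := (T (fst p) (cdart (snd p)), cnext (snd p)).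
Definition pflip (p : pos) : pos := (T (fst p) (cdart (snd p)), cflip (snd p)).
Definition pdart (p : pos) : V * cD X := (fst p, cdart (snd p)).
Definition drev (e : V * cD X) : V * cD X := (T (fst e) (snd e), rev (snd e)).

Lemma iter_pnext k p :
  Nat.iter k pnext p = (walk (fst p) (bword (snd p) k), Nat.iter k cnext (snd p)).
Proof.
  revert p; induction k as [|k IH]; intro p; [now destruct p|].
  rewrite Nat.iter_succ_r, IH, bword_S, (Nat.iter_succ_r _ _ (@cnext X)). reflexivity.
Qed.

Variant bstep (DP : V * cD X -> Prop) (CP : pos -> Prop) (v : V)
    (l1 l2 : list (cD X)) : list (cD X) -> Prop :=
| bstep_dart d : DP (walk v l1, d) -> bstep DP CP v l1 l2 (l1 ++ d :: rev d :: l2)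
| bstep_face c k : 0 < k -> Nat.iter k cnext c = c -> CP (walk v l1, c) ->
    bstep DP CP v l1 l2 (l1 ++ bword c k ++ l2).

Definition wstep DP CP (v : V) (l l' : list (cD X)) : Prop :=
  exists l1 l2, l' = l1 ++ l2 /\ bstep DP CP v l1 l2 l.

Definition whomot DP CP (v : V) : relation (list (cD X)) :=
  clos_refl_sym_trans _ (wstep DP CP v).

Fixpoint wvalid (DP : V * cD X -> Prop) (v : V) (l : list (cD X)) : Prop :=
  match l with
  | nil => True
  | d :: l' => DP (v, d) /\ wvalid DP (T v d) l'
  end.

(** [cp_loop] asks that every period of the underlying position closes up in [V]: 2-cells lift
    without branching, as [f_face_inj] demands of the map to [X]. *)
Record good (DP : V * cD X -> Prop) (CP : pos -> Prop) : Prop := Good {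
  dp_src : forall e, DP e -> phi (fst e) = src (snd e);
  dp_rev : forall e, DP e -> DP (drev e);
  cp_dp : forall p, CP p -> DP (pdart p);
  cp_next : forall p, CP p -> CP (pnext p);
  cp_flip : forall p, CP p -> CP (pflip p);
  cp_loop : forall p k, CP p -> 0 < k -> Nat.iter k cnext (snd p) = snd p ->
    walk (fst p) (bword (snd p) k) = fst p }.

Lemma wvalid_app DP v l1 l2 :
  wvalid DP v (l1 ++ l2) <-> wvalid DP v l1 /\ wvalid DP (walk v l1) l2.
Proof.
  revert v; induction l1 as [|d l IH]; intro v; simpl; [tauto|].
  rewrite IH. tauto.
Qed.

Lemma wvalid_mono (DP DP' : V * cD X -> Prop) v l :
  (forall e, DP e -> DP' e) -> wvalid DP v l -> wvalid DP' v l.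
Proof.
  intro HD. revert v; induction l as [|d l IH]; intro v; simpl; [tauto|].
  intros [H1 H2]; auto.
Qed.

Section Good.
Variables (DP : V * cD X -> Prop) (CP : pos -> Prop).
Hypothesis G : good DP CP.

Lemma T_back v d : DP (v, d) -> T (T v d) (rev d) = v.
Proof. intro He. exact (T_rev _ (dp_src G _ He)). Qed.

Lemma drev_invol e : DP e -> drev (drev e) = e.
Proof.
  intro He. destruct e as [v d]. unfold drev; simpl.
  rewrite T_rev by exact (dp_src G _ He). now rewrite rev_inv.
Qed.

Lemma cp_src p : CP p -> phi (fst p) = src (cdart (snd p)).
Proof. intro Hp. exact (dp_src G _ (cp_dp G _ Hp)). Qed.

Lemma pflip_invol p : CP p -> pflip (pflip p) = p.
Proof.
  intro Hp. destruct p as [v c]. unfold pflip; simpl.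
  rewrite cflip_dart, T_rev, cflip_inv by exact (cp_src Hp). reflexivity.
Qed.

Lemma pdart_flip p : pdart (pflip p) = drev (pdart p).
Proof. unfold pdart, drev, pflip; simpl. now rewrite cflip_dart. Qed.

Lemma pnext_flip_next p : CP p -> pnext (pflip (pnext p)) = pflip p.
Proof.
  intro Hp. destruct p as [v c]. unfold pflip, pnext; simpl.
  rewrite cflip_next, cflip_dart. f_equal. apply T_rev.
  exact (cp_src (cp_next G _ Hp)).
Qed.

Lemma cp_iter p k : CP p -> CP (Nat.iter k pnext p).
Proof. intro Hp. induction k as [|k IH]; simpl; [easy|]. now apply (cp_next G). Qed.

Lemma pnext_period p k : CP p -> Nat.iter k cnext (snd p) = snd p ->
  Nat.iter k pnext p = p.
Proof.
  intros Hp E. destruct k as [|k]; [reflexivity|].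
  rewrite iter_pnext, E, (cp_loop G) by (easy || lia). now destruct p.
Qed.

Lemma pnext_cycle p : CP p -> exists k, Nat.iter (S k) pnext p = p.
Proof.
  intro Hp. destruct (cycle_finite _ (snd p)) as ([|k] & Hk & Ek); [lia|].
  exists k. now apply pnext_period.
Qed.

(** The classes of this relation play the role of 2-cells: all positions on one boundary circle, in
    both orientations. *)
Inductive reach (p : pos) : pos -> Prop :=
| reach_refl : reach p p
| reach_next q : reach p q -> reach p (pnext q)
| reach_flip q : reach p q -> reach p (pflip q).

Lemma reach_cp p q : CP p -> reach p q -> CP q.
Proof.
  intros Hp. induction 1; [easy | now apply (cp_next G) | now apply (cp_flip G)].
Qed.

Lemma reach_trans p q r : reach p q -> reach q r -> reach p r.
Proof. intros Hpq. induction 1; [easy | now apply reach_next | now apply reach_flip]. Qed.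

Lemma reach_iter p k : reach p (Nat.iter k pnext p).
Proof. induction k; simpl; constructor; easy. Qed.

Lemma reach_sym p q : CP p -> reach p q -> reach q p.
Proof.
  intros Hp. induction 1 as [|q Hq IH|q Hq IH]; [constructor| |].
  - apply reach_trans with q; [|easy].
    destruct (pnext_cycle (reach_cp Hp Hq)) as [k Ek].
    rewrite <- Ek at 2. rewrite Nat.iter_succ_r. apply reach_iter.
  - apply reach_trans with q; [|easy].
    rewrite <- (pflip_invol (reach_cp Hp Hq)) at 2. apply reach_flip, reach_refl.
Qed.

Lemma reach_face p q : reach p q -> cface (snd q) = cface (snd p).
Proof.
  induction 1 as [|q Hq IH|q Hq IH]; simpl; [easy| |];
    now rewrite ?cnext_face, ?cflip_face.
Qed.

Lemma pflip_iter p k : CP p -> exists m, pflip (Nat.iter k pnext p) = Nat.iter m pnext (pflip p).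
Proof.
  intro Hp. induction k as [|k [m Em]]; [now exists 0|]. simpl.
  set (q := Nat.iter k pnext p) in *.
  assert (Hq : CP q) by now apply (cp_iter _ Hp).
  destruct (pnext_cycle (cp_flip G _ (cp_next G _ Hq))) as [j Ej].
  exists (j + m). rewrite Nat.iter_add, <- Em, <- (pnext_flip_next Hq).
  now rewrite <- Nat.iter_succ_r, Ej.
Qed.

Lemma reach_inv p q : CP p -> reach p q ->
  exists k, q = Nat.iter k pnext p \/ q = Nat.iter k pnext (pflip p).
Proof.
  intro Hp. induction 1 as [|q Hq [k [->| ->]]|q Hq [k [->| ->]]].
  - exists 0; now left.
  - exists (S k); now left.
  - exists (S k); now right.
  - destruct (pflip_iter k Hp) as [m ->]. exists m; now right.
  - destruct (pflip_iter k (cp_flip G _ Hp)) as [m ->]. exists m; left.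
    now rewrite pflip_invol.
Qed.

(** Two lifts in one 2-cell differ by an iterate, which is a period and closes up by [cp_loop], or
    by an iterate after a flip, which [orient_disj] excludes. *)
Lemma reach_snd_inj p q : CP p -> reach p q -> snd p = snd q -> p = q.
Proof.
  intros Hp Hr E. destruct (reach_inv Hp Hr) as [k [->| ->]]; rewrite iter_pnext in E; simpl in E.
  - symmetry. now apply pnext_period.
  - destruct (@orient_disj _ (cflip (snd p)) k). now rewrite cflip_inv.
Qed.

Lemma reach_finite p : CP p -> exists L, forall q, reach p q -> In q L.
Proof.
  intro Hp.
  assert (P : forall p, CP p -> exists L, forall k, In (Nat.iter k pnext p) L).
  { clear p Hp. intros p Hp. destruct (pnext_cycle Hp) as [k Ek].
    exists (map (fun j => Nat.iter j pnext p) (seq 0 (S k))).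
    induction k0 as [|j IH]; [now left|].
    apply in_map_iff in IH as (i & Ei & Hi). apply in_seq in Hi.
    simpl. rewrite <- Ei. destruct (Nat.eq_dec i k) as [->|Hn].
    - left. symmetry. exact Ek.
    - change (In (Nat.iter (S i) pnext p) (map (fun j => Nat.iter j pnext p) (seq 0 (S k)))).
      apply (in_map (fun j => Nat.iter j pnext p)), in_seq. lia. }
  destruct (P p Hp) as [L1 H1]. destruct (P _ (cp_flip G _ Hp)) as [L2 H2].
  exists (L1 ++ L2). intros q Hq. apply in_or_app.
  destruct (reach_inv Hp Hq) as [k [->| ->]]; auto.
Qed.

Lemma wvalid_bword v c k : CP (v, c) -> wvalid DP v (bword c k).
Proof.
  revert v c; induction k as [|k IH]; intros v c Hp; [exact I|].
  rewrite bword_S. split; [exact (cp_dp G _ Hp)|]. apply IH. exact (cp_next G _ Hp).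
Qed.

Lemma walk_winv v l : wvalid DP v l -> walk (walk v l) (winv l) = v.
Proof.
  revert v; induction l as [|d l IH]; intros v; [reflexivity|].
  intros [H1 H2]. rewrite walk_cons, winv_cons, walk_app, IH by easy.
  exact (T_back H1).
Qed.

Lemma wvalid_winv v l : wvalid DP v l -> wvalid DP (walk v l) (winv l).
Proof.
  revert v; induction l as [|d l IH]; intros v; [easy|].
  intros [H1 H2]. rewrite walk_cons, winv_cons, wvalid_app. split; [now apply IH|].
  rewrite walk_winv by easy. split; [exact (dp_rev G _ H1)|exact I].
Qed.

Lemma bstep_walk v l1 l2 l : bstep DP CP v l1 l2 l -> walk v l = walk v (l1 ++ l2).
Proof.
  intros [d Hd|c k Hk E Hc]; rewrite !walk_app.
  - now rewrite !walk_cons, (T_back Hd).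
  - f_equal. exact (cp_loop G _ Hc Hk E).
Qed.

Lemma bstep_valid v l1 l2 l :
  bstep DP CP v l1 l2 l -> (wvalid DP v l <-> wvalid DP v (l1 ++ l2)).
Proof.
  intros [d Hd|c k Hk E Hc]; rewrite !wvalid_app; simpl.
  - rewrite (T_back Hd). simpl.
    pose proof (dp_rev G _ Hd) as Hr. unfold drev in Hr; simpl in Hr. tauto.
  - pose proof (cp_loop G _ Hc Hk E) as E'; simpl in E'. rewrite E'.
    pose proof (wvalid_bword k Hc). tauto.
Qed.

Lemma whomot_walk v l l' : whomot DP CP v l l' -> walk v l = walk v l'.
Proof.
  induction 1 as [l l' (l1 & l2 & -> & H)| | |]; [now apply bstep_walk|easy|easy|congruence].
Qed.

(** Each move inserts or removes a closed word that is itself valid, so validity at one end of a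
    homotopy gives it at all intermediate words. *)
Lemma whomot_valid v l l' : whomot DP CP v l l' -> (wvalid DP v l <-> wvalid DP v l').
Proof.
  induction 1 as [l l' (l1 & l2 & -> & H)| | |]; [now apply bstep_valid|tauto|tauto|tauto].
Qed.

Lemma whomot_app_l v a l l' : whomot DP CP (walk v a) l l' -> whomot DP CP v (a ++ l) (a ++ l').
Proof.
  induction 1 as [l l' (l1 & l2 & -> & H)| | |].
  - apply rst_step. exists (a ++ l1), l2. split; [now rewrite app_assoc|].
    destruct H as [d H|c k Hk E H]; rewrite <- walk_app in H.
    + rewrite app_assoc. now constructor.
    + rewrite app_assoc. now constructor.
  - apply rst_refl.
  - now apply rst_sym.
  - eapply rst_trans; eassumption.
Qed.

Lemma whomot_app_r v a l l' : whomot DP CP v l l' -> whomot DP CP v (l ++ a) (l' ++ a).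
Proof.
  induction 1 as [l l' (l1 & l2 & -> & H)| | |].
  - apply rst_step. exists l1, (l2 ++ a). split; [now rewrite app_assoc|].
    destruct H as [d H|c k Hk E H].
    + replace ((l1 ++ d :: rev d :: l2) ++ a) with (l1 ++ d :: rev d :: (l2 ++ a))
        by now rewrite <- app_assoc.
      now constructor.
    + rewrite <- !app_assoc. now constructor.
  - apply rst_refl.
  - now apply rst_sym.
  - eapply rst_trans; eassumption.
Qed.

Lemma whomot_winv_r v l : wvalid DP v l -> whomot DP CP v (l ++ winv l) nil.
Proof.
  revert v; induction l as [|d l IH]; intros v; [intros; apply rst_refl|].
  intros [H1 H2]. rewrite winv_cons. simpl. rewrite app_assoc.
  eapply rst_trans.
  - apply (@whomot_app_l v [d]). apply whomot_app_r. now apply IH.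
  - apply rst_step. exists nil, nil. split; [easy|]. now apply (@bstep_dart DP CP v nil nil d).
Qed.

Lemma whomot_winv_l v l : wvalid DP v l -> whomot DP CP (walk v l) (winv l ++ l) nil.
Proof.
  intro H. rewrite <- (winv_invol _ l) at 3. apply whomot_winv_r. now apply wvalid_winv.
Qed.

End Good.

End Walks.

Arguments walk {X V} T v l.
Arguments drev {X V} T e.
Arguments pnext {X V} T p.
Arguments pflip {X V} T p.
Arguments wvalid {X V} T DP v l.
Arguments T_back {X V phi T} _ {DP CP} _ {v d} _.
Arguments drev_invol {X V phi T} _ {DP CP} _ {e} _.
Arguments cp_src {X V phi T DP CP} _ {p} _.
Arguments pflip_invol {X V phi T} _ {DP CP} _ {p} _.
Arguments pnext_flip_next {X V phi T} _ {DP CP} _ {p} _.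
Arguments reach_finite {X V phi T} _ {DP CP} _ {p} _.
Arguments wvalid_bword {X V phi T DP CP} _ {v c} k _.
Arguments walk_winv {X V phi T} _ {DP CP} _ {v l} _.
Arguments wvalid_winv {X V phi T} _ {DP CP} _ {v l} _.
Arguments whomot_winv_r {X V T DP} CP {v l} _.
Arguments whomot_winv_l {X V phi T} _ {DP CP} _ {v l} _.

(** * Deleting 1-cells traversed at most once: injectivity on fundamental groups *)

Section Deletion.
Variable X : complex.
Variable V : Type.
Variable phi : V -> cV X.
Variable T : V -> cD X -> V.
Hypothesis T_rev : forall v d, phi v = src d -> T (T v d) (rev d) = v.
Variables (DP : V * cD X -> Prop) (CP : pos X V -> Prop).
Hypothesis G : good phi T DP CP.
Variable E : V * cD X -> Prop.
Hypothesis E_rev : forall e, E e -> E (drev T e).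
(** Positions carry an orientation and each has a flip on the reverse dart, so uniqueness on a dart
    means that its 1-cell is traversed at most once, counting both directions. *)
Hypothesis E_thin : forall p q, CP p -> CP q -> E (pdart p) -> pdart p = pdart q -> p = q.

Definition dp_del (e : V * cD X) : Prop := DP e /\ ~ E e.
Definition cp_del (p : pos X V) : Prop :=
  CP p /\ forall q, reach T p q -> ~ E (pdart q).

Lemma good_del : good phi T dp_del cp_del.
Proof.
  split.
  - intros e [He _]. exact (dp_src G _ He).
  - intros e [He HE]. split; [exact (dp_rev G _ He)|].
    intro H. apply HE. rewrite <- (drev_invol T_rev G He). now apply E_rev.
  - intros p [Hp HE]. split; [exact (cp_dp G _ Hp)|]. apply HE. constructor.
  - intros p [Hp HE]. split; [exact (cp_next G _ Hp)|]. intros q Hq. apply HE.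
    eapply reach_trans; [|exact Hq]. apply reach_next, reach_refl.
  - intros p [Hp HE]. split; [exact (cp_flip G _ Hp)|]. intros q Hq. apply HE.
    eapply reach_trans; [|exact Hq]. apply reach_flip, reach_refl.
  - intros p k [Hp _]. exact (cp_loop G _ Hp).
Qed.

Let G' := good_del.
Variable v0 : V.
Let h := whomot T dp_del cp_del v0.
Let loop (l : list (cD X)) : Prop := wvalid T dp_del v0 l /\ walk T v0 l = v0.

Lemma loop_nil : loop nil.
Proof. now split. Qed.

Lemma loop_app a b : loop a -> loop b -> loop (a ++ b).
Proof.
  intros [Ha Ea] [Hb Eb]. split.
  - rewrite wvalid_app, Ea. easy.
  - now rewrite walk_app, Ea.
Qed.

Lemma loop_winv a : loop a -> loop (winv a).
Proof.
  intros [Ha Ea]. split.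
  - rewrite <- Ea. now apply (wvalid_winv T_rev G').
  - rewrite <- Ea at 1. now apply (walk_winv T_rev G').
Qed.

Lemma h_app a a' b b' : loop a -> h a a' -> h b b' -> h (a ++ b) (a' ++ b').
Proof.
  intros [Ha Ea] H1 H2. eapply rst_trans.
  - apply whomot_app_l. rewrite Ea. exact H2.
  - now apply whomot_app_r.
Qed.

Lemma h_winv_r a : loop a -> h (a ++ winv a) nil.
Proof. intros [Ha _]. now apply (whomot_winv_r cp_del). Qed.

Lemma h_winv_l a : loop a -> h (winv a ++ a) nil.
Proof. intros Ha. rewrite <- (winv_invol _ a) at 2. now apply h_winv_r, loop_winv. Qed.

Lemma h_cancel a x y : loop a -> h (a ++ x) (a ++ y) -> h x y.
Proof.
  intros Ha H.
  assert (P : forall z, h (winv a ++ a ++ z) z).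
  { intro z. rewrite app_assoc. apply (whomot_app_r z (h_winv_l Ha)). }
  eapply rst_trans; [apply rst_sym, P|]. eapply rst_trans; [|apply P].
  apply whomot_app_l. now rewrite (proj2 (loop_winv Ha)).
Qed.

Fixpoint hol (rho : V * cD X -> list (cD X)) (v : V) (l : list (cD X)) : list (cD X) :=
  match l with
  | nil => nil
  | d :: l' => rho (v, d) ++ hol rho (T v d) l'
  end.

Lemma hol_app rho v l1 l2 : hol rho v (l1 ++ l2) = hol rho v l1 ++ hol rho (walk T v l1) l2.
Proof.
  revert v; induction l1 as [|d l IH]; intro v; simpl; [easy|].
  now rewrite IH, app_assoc.
Qed.

Lemma hol_loop rho v l : (forall e, loop (rho e)) -> loop (hol rho v l).
Proof.
  intro Hr. revert v; induction l as [|d l IH]; intro v; simpl; [apply loop_nil|].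
  now apply loop_app.
Qed.

(** A retraction of words onto loops at [v0] that avoid [E]: darts that survive in the
    component of [v0] become loops through a spanning tree, all others are collapsed or
    replaced below. It exhibits deletion as injective on fundamental groups. *)
Definition joined (v : V) : Prop := exists l, wvalid T dp_del v0 l /\ walk T v0 l = v.
Definition tree (v : V) : list (cD X) :=
  epsilon (inhabits nil) (fun l => wvalid T dp_del v0 l /\ walk T v0 l = v).

Lemma tree_spec v : joined v -> wvalid T dp_del v0 (tree v) /\ walk T v0 (tree v) = v.
Proof.
  exact (epsilon_spec (inhabits nil) (fun l => wvalid T dp_del v0 l /\ walk T v0 l = v)).
Qed.

Lemma joined_T v d : dp_del (v, d) -> joined v -> joined (T v d).
Proof.
  intros Hd (l & Hl & El). exists (l ++ [d]).
  rewrite wvalid_app, walk_app, El. simpl. tauto.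
Qed.

Lemma joined_T_inv v d : dp_del (v, d) -> joined (T v d) -> joined v.
Proof.
  intros Hd H. rewrite <- (T_back T_rev G' Hd). apply joined_T; [|easy].
  exact (dp_rev G' _ Hd).
Qed.

Definition hol_free (e : V * cD X) : list (cD X) :=
  if excluded_middle_informative (dp_del e /\ joined (fst e))
  then tree (fst e) ++ snd e :: winv (tree (T (fst e) (snd e))) else nil.

Lemma hol_free_loop e : loop (hol_free e).
Proof.
  unfold hol_free. destruct (excluded_middle_informative _) as [[H1 H2]|]; [|apply loop_nil].
  destruct e as [v d]; simpl in *.
  destruct (tree_spec H2) as [A1 A2].
  destruct (tree_spec (joined_T H1 H2)) as [B1 B2].
  split.
  - rewrite wvalid_app, A2. split; [easy|]. split; [easy|].
    rewrite <- B2 at 1. now apply (wvalid_winv T_rev G').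
  - rewrite walk_app, A2, walk_cons. rewrite <- B2 at 1. now apply (walk_winv T_rev G').
Qed.

Lemma hol_free_rev e : DP e -> h (hol_free e ++ hol_free (drev T e)) nil.
Proof.
  intro He. destruct e as [v d]. unfold hol_free at 1.
  destruct (excluded_middle_informative _) as [[H1 H2]|H]; simpl in *.
  - destruct (tree_spec H2) as [A1 A2].
    destruct (tree_spec (joined_T H1 H2)) as [B1 B2].
    assert (L := hol_free_loop (v, d)). unfold hol_free in *; simpl in *.
    destruct (excluded_middle_informative _) as [_|N] in L; [|tauto].
    destruct (excluded_middle_informative _) as [_|N].
    2: { destruct N. split; [exact (dp_rev G' _ H1)|now apply joined_T]. }
    simpl. rewrite (T_back T_rev G' H1).
    replace (tree (T v d) ++ rev d :: winv (tree v))
      with (winv (tree v ++ d :: winv (tree (T v d)))).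
    + now apply h_winv_r.
    + rewrite winv_app, winv_cons, winv_invol, <- app_assoc. reflexivity.
  - unfold hol_free. destruct (excluded_middle_informative _) as [[H1 H2]|]; [|apply rst_refl].
    destruct H. simpl in *.
    assert (D : dp_del (v, d)).
    { rewrite <- (drev_invol T_rev G He). exact (dp_rev G' _ H1). }
    split; [easy|]. now apply (joined_T_inv D).
Qed.

(** Telescoping: the return path of each letter cancels the tree path with which the next letter
    begins. *)
Lemma hol_free_joined v l : wvalid T dp_del v l -> joined v ->
  h (tree v ++ l) (hol hol_free v l ++ tree (walk T v l)).
Proof.
  revert v; induction l as [|d l IH]; intros v Hl Hv.
  - simpl. rewrite app_nil_r. apply rst_refl.
  - destruct Hl as [Hd Hl]. simpl hol. rewrite walk_cons.
    assert (H2 : joined (T v d)) by now apply joined_T.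
    assert (L := hol_free_loop (v, d)).
    apply rst_trans with (hol_free (v, d) ++ tree (T v d) ++ l).
    + unfold hol_free. destruct (excluded_middle_informative _) as [_|N]; [|tauto]. simpl.
      rewrite <- app_assoc. simpl.
      apply whomot_app_l. rewrite (proj2 (tree_spec Hv)).
      change (whomot T dp_del cp_del v ([d] ++ l)
               ([d] ++ winv (tree (T v d)) ++ tree (T v d) ++ l)).
      apply whomot_app_l. apply rst_sym. rewrite app_assoc.
      apply (@whomot_app_r _ _ _ _ _ _ l _ nil).
      change (walk T v [d]) with (T v d). rewrite <- (proj2 (tree_spec H2)) at 1.
      apply (whomot_winv_l T_rev G'). now apply tree_spec.
    + rewrite <- app_assoc. apply h_app; [easy|apply rst_refl|]. now apply IH.
Qed.

Lemma hol_free_unjoined v l : wvalid T dp_del v l -> ~ joined v -> hol hol_free v l = nil.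
Proof.
  revert v; induction l as [|d l IH]; intros v Hl Hv; [easy|].
  destruct Hl as [Hd Hl]. simpl. rewrite IH; [|easy|].
  - unfold hol_free. destruct (excluded_middle_informative _) as [[_ H]|]; easy.
  - intro H. apply Hv. now apply (joined_T_inv Hd).
Qed.

(** Every 2-cell with a deleted 1-cell gets one chosen position on a deleted 1-cell; the
    holonomy of that 1-cell is defined so as to make the boundary of the 2-cell trivial. *)
Definition pick (p : pos X V) : pos X V :=
  epsilon (inhabits p) (fun q => reach T p q /\ E (pdart q)).

Definition chosen (p : pos X V) : Prop := CP p /\ E (pdart p) /\ pick p = p.

(** The predicate given to [epsilon] depends only on the 2-cell, so by extensionality all its
    positions, flipped ones included, make the same choice. *)
Lemma pick_reach p q : CP p -> reach T p q -> pick p = pick q.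
Proof.
  intros Hp Hr. unfold pick. f_equal; [apply proof_irrelevance|].
  apply functional_extensionality. intro r. apply propositional_extensionality.
  assert (Hq := reach_sym T_rev G Hp Hr).
  split; intros [H1 H2]; (split; [|easy]); eapply reach_trans; eassumption.
Qed.

Lemma pick_chosen p q : CP p -> reach T p q -> E (pdart q) -> chosen (pick p).
Proof.
  intros Hp Hr He.
  assert (H : reach T p (pick p) /\ E (pdart (pick p))).
  { apply (epsilon_spec (inhabits p) (fun q => reach T p q /\ E (pdart q))). now exists q. }
  destruct H as [H1 H2]. split; [exact (reach_cp G Hp H1)|]. split; [easy|].
  symmetry. now apply pick_reach.
Qed.

Lemma chosen_reach p q : chosen p -> chosen q -> reach T p q -> p = q.
Proof.
  intros (Hp & _ & Ep) (_ & _ & Eq) Hr. rewrite <- Ep, <- Eq. now apply pick_reach.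
Qed.

(** The least period minus one: the number of positions that remain after [p] in a single turn. *)
Definition rest_len (p : pos X V) : nat :=
  epsilon (inhabits 0) (fun k => Nat.iter (S k) cnext (snd p) = snd p /\
    forall j, 0 < j <= k -> Nat.iter j cnext (snd p) <> snd p).

Lemma rest_len_spec p : Nat.iter (S (rest_len p)) cnext (snd p) = snd p /\
    forall j, 0 < j <= rest_len p -> Nat.iter j cnext (snd p) <> snd p.
Proof.
  apply (epsilon_spec (inhabits 0) (fun k => Nat.iter (S k) cnext (snd p) = snd p /\
    forall j, 0 < j <= k -> Nat.iter j cnext (snd p) <> snd p)), least_period.
Qed.

(** Using [hol_free] here avoids circularity, since [rho] is defined from [rest]; [hol_rest] shows
    that both give the same holonomy on this word. *)
Definition rest (p : pos X V) : list (cD X) :=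
  hol hol_free (T (fst p) (cdart (snd p))) (bword (cnext (snd p)) (rest_len p)).

Lemma rest_loop p : loop (rest p).
Proof. apply hol_loop, hol_free_loop. Qed.

Definition rho (e : V * cD X) : list (cD X) :=
  match excluded_middle_informative (exists p, chosen p /\ pdart p = e) with
  | left H => winv (rest (proj1_sig (constructive_indefinite_description _ H)))
  | right _ =>
    match excluded_middle_informative (exists p, chosen p /\ drev T (pdart p) = e) with
    | left H => rest (proj1_sig (constructive_indefinite_description _ H))
    | right _ => hol_free e
    end
  end.

Lemma chosen_dart p q : chosen p -> CP q -> pdart p = pdart q -> p = q.
Proof. intros (Hp & He & _) Hq. now apply E_thin. Qed.

Lemma chosen_drev p q : chosen p -> CP q -> drev T (pdart p) = pdart q -> pflip T p = q.
Proof.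
  intros (Hp & He & _) Hq Ed. apply E_thin; [exact (cp_flip G _ Hp)|easy| |].
  - rewrite pdart_flip. now apply E_rev.
  - now rewrite pdart_flip.
Qed.

Lemma rho_chosen p : chosen p -> rho (pdart p) = winv (rest p).
Proof.
  intro Hp. unfold rho. destruct (excluded_middle_informative _) as [H|N].
  - destruct (constructive_indefinite_description _ H) as (q & Hq & Eq); simpl.
    now rewrite (chosen_dart Hq (proj1 Hp) Eq).
  - destruct N. now exists p.
Qed.

Lemma rho_chosen_rev p : chosen p -> rho (drev T (pdart p)) = rest p.
Proof.
  intro Hp. unfold rho. destruct (excluded_middle_informative _) as [(q & Hq & Eq)|N].
  (* A chosen position on the reverse dart would be the flip of [p]; lying in the same 2-cell it
     would be [p] itself, but no position equals its flip. *)
  - exfalso. symmetry in Eq. assert (Ef := chosen_drev Hp (proj1 Hq) Eq).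
    assert (Er : p = q). { apply chosen_reach; [easy..|]. rewrite <- Ef. apply reach_flip, reach_refl. }
    rewrite <- Er in Ef. apply (@orient_disj _ (snd p) 0). exact (f_equal snd (eq_sym Ef)).
  - destruct (excluded_middle_informative _) as [H|N'].
    + destruct (constructive_indefinite_description _ H) as (q & Hq & Eq); simpl.
      rewrite <- (pdart_flip T p) in Eq.
      assert (Ef := chosen_drev Hq (cp_flip G _ (proj1 Hp)) Eq).
      f_equal. rewrite <- (pflip_invol T_rev G (proj1 Hp)), <- Ef.
      now rewrite (pflip_invol T_rev G (proj1 Hq)).
    + destruct N'. now exists p.
Qed.

Lemma rho_free e : (forall p, chosen p -> pdart p <> e) ->
  (forall p, chosen p -> drev T (pdart p) <> e) -> rho e = hol_free e.
Proof.
  intros N1 N2. unfold rho. destruct (excluded_middle_informative _) as [(q & Hq & Eq)|_].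
  - now destruct (N1 q Hq).
  - destruct (excluded_middle_informative _) as [(q & Hq & Eq)|_]; [|easy].
    now destruct (N2 q Hq).
Qed.

Lemma rho_kept e : ~ E e -> rho e = hol_free e.
Proof.
  intro N. apply rho_free; intros p (_ & He & _) <-; [easy|]. now apply N, E_rev.
Qed.

Lemma rho_cases e : (exists p, chosen p /\ pdart p = e) \/
  (exists p, chosen p /\ drev T (pdart p) = e) \/
  (forall p, chosen p -> pdart p <> e) /\ (forall p, chosen p -> drev T (pdart p) <> e).
Proof.
  destruct (classic (exists p, chosen p /\ pdart p = e)) as [H|N1]; [now left|].
  destruct (classic (exists p, chosen p /\ drev T (pdart p) = e)) as [H|N2]; [now right; left|].
  right; right. split; intros p Hp Ep; [apply N1|apply N2]; now exists p.
Qed.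

Lemma rho_loop e : loop (rho e).
Proof.
  destruct (rho_cases e) as [(p & Hp & <-)|[(p & Hp & <-)|[N1 N2]]].
  - rewrite rho_chosen by easy. apply loop_winv, rest_loop.
  - rewrite rho_chosen_rev by easy. apply rest_loop.
  - rewrite rho_free by easy. apply hol_free_loop.
Qed.

Lemma rho_rev e : DP e -> h (rho e ++ rho (drev T e)) nil.
Proof.
  intro He. destruct (rho_cases e) as [(p & Hp & <-)|[(p & Hp & <-)|[N1 N2]]].
  - rewrite rho_chosen, rho_chosen_rev by easy. apply h_winv_l, rest_loop.
  - rewrite (drev_invol T_rev G) by exact (cp_dp G _ (proj1 Hp)).
    rewrite rho_chosen, rho_chosen_rev by easy. apply h_winv_r, rest_loop.
  - rewrite !rho_free; [now apply hol_free_rev|..|easy|easy]; intros p Hp Ep.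
    + apply (N2 p Hp). rewrite Ep. now apply (drev_invol T_rev G).
    + apply (N1 p Hp). rewrite <- (drev_invol T_rev G He), <- Ep.
      symmetry. apply (drev_invol T_rev G). exact (cp_dp G _ (proj1 Hp)).
Qed.

Lemma hol_rho_loop v l : loop (hol rho v l).
Proof. apply hol_loop, rho_loop. Qed.

Lemma hol_rho_winv v l : wvalid T DP v l -> h (hol rho v l ++ hol rho (walk T v l) (winv l)) nil.
Proof.
  revert v; induction l as [|d l IH]; intros v Hl; [apply rst_refl|].
  destruct Hl as [Hd Hl]. rewrite walk_cons, winv_cons, hol_app, (walk_winv T_rev G Hl).
  simpl. rewrite app_nil_r, <- app_assoc, (app_assoc (hol rho (T v d) l)).
  eapply rst_trans; [|exact (rho_rev Hd)].
  apply h_app; [apply rho_loop|apply rst_refl|].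
  apply (whomot_app_r (rho (drev T (v, d))) (IH _ Hl)).
Qed.

Lemma hol_rho_kept v l : wvalid T dp_del v l -> hol rho v l = hol hol_free v l.
Proof.
  revert v; induction l as [|d l IH]; intros v Hl; [easy|].
  destruct Hl as [[_ Hd] Hl]. simpl. now rewrite rho_kept, IH.
Qed.

Let trivial_face (q : pos X V) : Prop := forall k, 0 < k -> Nat.iter k cnext (snd q) = snd q ->
  h (hol rho (fst q) (bword (snd q) k)) nil.

(** Moving the starting point conjugates the boundary product by the holonomy of the first side. *)
Lemma trivial_next q : CP q -> trivial_face q -> trivial_face (pnext T q).
Proof.
  intros Hq Ht k Hk Ek. destruct q as [v c]; simpl in *.
  rewrite <- Nat.iter_succ_r in Ek. simpl in Ek. apply cnext_inj in Ek.
  apply (@h_cancel (rho (v, cdart c))); [apply rho_loop|].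
  change (rho (v, cdart c) ++ hol rho (T v (cdart c)) (bword (cnext c) k))
    with (hol rho v (cdart c :: bword (cnext c) k)).
  rewrite <- bword_S, <- Nat.add_1_r, bword_add, hol_app, Ek.
  pose proof (cp_loop G _ Hq Hk Ek) as E'; simpl in E'. rewrite E'.
  unfold bword at 2; simpl. rewrite !app_nil_r.
  apply (whomot_app_r (rho (v, cdart c)) (Ht k Hk Ek)).
Qed.

(** The word read from the flip is the inverse of the boundary word read from the next position, and
    inverse words have inverse holonomies up to homotopy. *)
Lemma trivial_flip q : CP q -> trivial_face q -> trivial_face (pflip T q).
Proof.
  intros Hq Ht k Hk Ek. assert (Hn := trivial_next Hq Ht).
  destruct q as [v c]; simpl in *. apply iter_flip_period in Ek.
  destruct k as [|j]; [lia|].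
  assert (Ek' : Nat.iter (S j) cnext (cnext c) = cnext c).
  { rewrite <- Nat.iter_succ_r. simpl. simpl in Ek. now rewrite Ek. }
  specialize (Hn (S j) Hk Ek'). cbn [fst snd pnext] in Hn.
  replace (bword (cflip c) (S j)) with (winv (bword (cnext c) (S j))).
  2: { rewrite winv_bword. do 2 f_equal. now rewrite <- Nat.iter_succ_r. }
  assert (Hv : wvalid T DP (T v (cdart c)) (bword (cnext c) (S j))).
  { apply (wvalid_bword G). exact (cp_next G _ Hq). }
  assert (Hw := hol_rho_winv _ _ Hv).
  pose proof (cp_loop G _ (cp_next G _ Hq) Hk Ek') as E'; cbn [fst snd pnext] in E'. rewrite E' in Hw.
  eapply rst_trans; [|exact Hw].
  change (hol rho (T v (cdart c)) (winv (bword (cnext c) (S j))))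
    with (nil ++ hol rho (T v (cdart c)) (winv (bword (cnext c) (S j)))) at 1.
  apply rst_sym. apply h_app; [apply hol_rho_loop|exact Hn|apply rst_refl].
Qed.

Lemma trivial_reach p q : CP p -> reach T p q -> trivial_face p -> trivial_face q.
Proof.
  intros Hp Hr Ht. induction Hr as [|q Hq IH|q Hq IH]; [easy| |].
  - apply trivial_next; [exact (reach_cp G Hp Hq)|easy].
  - apply trivial_flip; [exact (reach_cp G Hp Hq)|easy].
Qed.

(** The boundary of a surviving 2-cell still bounds, and its holonomy is that word conjugated by a
    tree path. Outside the component of [v0] the holonomy is the empty word. *)
Lemma trivial_kept q : cp_del q -> trivial_face q.
Proof.
  intros Hq k Hk Ek. destruct q as [v c]; simpl in *.
  assert (Hv := wvalid_bword G' k Hq).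
  rewrite hol_rho_kept by easy.
  destruct (classic (joined v)) as [J|J].
  2: { rewrite hol_free_unjoined by easy. apply rst_refl. }
  assert (H := hol_free_joined _ Hv J).
  pose proof (cp_loop G' _ Hq Hk Ek) as E'; simpl in E'. rewrite E' in H.
  destruct (tree_spec J) as [A1 A2].
  assert (B : h (hol hol_free v (bword c k) ++ tree v) (tree v)).
  { eapply rst_trans; [apply rst_sym; exact H|].
    apply rst_step. exists (tree v), nil. split; [now rewrite app_nil_r|].
    rewrite <- (app_nil_r (bword c k)). constructor; [easy..|]. now rewrite A2. }
  apply (whomot_app_r (winv (tree v))) in B. rewrite <- app_assoc in B.
  eapply rst_trans; [|eapply rst_trans; [exact B|]].
  - rewrite <- (app_nil_r (hol hol_free v (bword c k))) at 1.
    apply h_app; [apply hol_loop, hol_free_loop|apply rst_refl|].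
    apply rst_sym. now apply (whomot_winv_r cp_del).
  - now apply (whomot_winv_r cp_del).
Qed.

(** Within one turn no later side is chosen or the reverse of a chosen one: by thinness and the
    single choice per 2-cell, it would force an early return to [p], against minimality of the
    period, or a visit to its flip, against [orient_disj]. *)
Lemma hol_rest p : chosen p ->
  hol rho (T (fst p) (cdart (snd p))) (bword (cnext (snd p)) (rest_len p)) = rest p.
Proof.
  intro Hp. unfold rest. destruct (rest_len_spec p) as [_ Hmin].
  assert (P : forall n j, 0 < j -> j + n <= S (rest_len p) ->
     hol rho (fst (Nat.iter j (pnext T) p)) (bword (snd (Nat.iter j (pnext T) p)) n) =
     hol hol_free (fst (Nat.iter j (pnext T) p)) (bword (snd (Nat.iter j (pnext T) p)) n)).
  { induction n as [|n IH]; intros j Hj Hn; [reflexivity|].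
    set (q := Nat.iter j (pnext T) p). rewrite bword_S. simpl. f_equal.
    - assert (Hr : reach T p q) by apply reach_iter.
      assert (Hq : CP q) by exact (reach_cp G (proj1 Hp) Hr).
      apply rho_free; intros r Hc Er.
      + assert (Eq := chosen_dart Hc Hq Er). subst r.
        assert (Ep := chosen_reach Hp Hc Hr).
        apply (Hmin j); [lia|]. rewrite Ep at 2. unfold q. now rewrite iter_pnext.
      + assert (Eq := chosen_drev Hc Hq Er).
        assert (Hr' : reach T p r).
        { apply reach_trans with q; [easy|].
          rewrite <- (pflip_invol T_rev G (proj1 Hc)), Eq. apply reach_flip, reach_refl. }
        assert (Ep := chosen_reach Hp Hc Hr'). subst r.
        apply (@orient_disj _ (snd p) j).
        change (cflip (snd p)) with (snd (pflip T p)). rewrite Eq.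
        unfold q. now rewrite iter_pnext.
    - apply (IH (S j)); lia. }
  apply (P (rest_len p) 1); lia.
Qed.

Lemma trivial_chosen p : chosen p -> trivial_face p.
Proof.
  intros Hp. destruct (rest_len_spec p) as [Ek Hmin].
  assert (B : h (hol rho (fst p) (bword (snd p) (S (rest_len p)))) nil).
  { rewrite bword_S. simpl. rewrite hol_rest by easy.
    change (fst p, cdart (snd p)) with (pdart p). rewrite rho_chosen by easy.
    apply h_winv_l, rest_loop. }
  (* [trivial_face] speaks of every period, so full turns of least length are split off one at a
     time. *)
  intro k. induction k as [k IH] using (well_founded_induction lt_wf). intros Hk E'.
  destruct (le_lt_dec k (rest_len p)) as [Hle|Hlt]; [now destruct (Hmin k)|].
  replace k with (S (rest_len p) + (k - S (rest_len p))) in * by lia.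
  set (n := k - S (rest_len p)) in *.
  rewrite bword_add, hol_app, Ek, (cp_loop G _ (proj1 Hp)) by (lia || easy).
  assert (En : Nat.iter n cnext (snd p) = snd p).
  { rewrite Nat.add_comm, Nat.iter_add, Ek in E'. exact E'. }
  destruct n as [|m].
  - unfold bword at 2; simpl. now rewrite app_nil_r.
  - apply (@h_app _ nil _ nil); [apply hol_rho_loop|easy|]. apply IH; [lia|lia|easy].
Qed.

Lemma trivial_all q : CP q -> trivial_face q.
Proof.
  intro Hq. destruct (classic (exists r, reach T q r /\ E (pdart r))) as [(r & Hr & He)|N].
  - assert (Hc := pick_chosen Hq Hr He).
    apply (@trivial_reach (pick q)); [exact (proj1 Hc)| |now apply trivial_chosen].
    apply (reach_sym T_rev G Hq).
    apply (epsilon_spec (inhabits q) (fun q' => reach T q q' /\ E (pdart q'))). now exists r.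
  - apply trivial_kept. split; [easy|]. intros r Hr He. apply N. now exists r.
Qed.

Lemma hol_rho_whomot v l l' : whomot T DP CP v l l' -> h (hol rho v l) (hol rho v l').
Proof.
  induction 1 as [l l' (l1 & l2 & -> & H)| | |].
  - destruct H as [d H|c k Hk Ek H]; rewrite !hol_app;
      (apply h_app; [apply hol_rho_loop|apply rst_refl|]).
    + simpl. rewrite (T_back T_rev G H), app_assoc.
      apply (whomot_app_r (hol rho (walk T v l1) l2) (rho_rev H)).
    + pose proof (cp_loop G _ H Hk Ek) as E'; simpl in E'. rewrite E'.
      apply (whomot_app_r (hol rho (walk T v l1) l2) (trivial_all H Hk Ek)).
  - apply rst_refl.
  - now apply rst_sym.
  - eapply rst_trans; eassumption.
Qed.

(** Holonomy sends a homotopy of the large complex to one of the deleted complex, and on surviving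
    words it changes nothing but the tree paths at the two ends. *)
Lemma whomot_del l l' : wvalid T dp_del v0 l -> wvalid T dp_del v0 l' ->
  whomot T DP CP v0 l l' -> whomot T dp_del cp_del v0 l l'.
Proof.
  intros Hl Hl' H. assert (Ew := whomot_walk T_rev G H).
  assert (J : joined v0) by now exists nil.
  destruct (tree_spec J) as [A1 A2].
  (* [tree v0] is an arbitrary choice and may be a nonempty loop, so it has to be cancelled. *)
  apply (@h_cancel (tree v0)); [now split|].
  eapply rst_trans; [now apply hol_free_joined|].
  eapply rst_trans; [|apply rst_sym; now apply hol_free_joined].
  rewrite Ew. apply whomot_app_r. rewrite <- !hol_rho_kept by easy.
  now apply hol_rho_whomot.
Qed.

End Deletion.
Arguments dp_del {X V} DP E e.

(** * The complex of a partial action *)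

Lemma sig_eq (A : Type) (P : A -> Prop) (x y : {a | P a}) :
  proj1_sig x = proj1_sig y -> x = y.
Proof.
  destruct x as [x Hx], y as [y Hy]; simpl. intros <-. f_equal. apply proof_irrelevance.
Qed.

Lemma list_sig (A : Type) (P : A -> Prop) (L : list A) :
  exists L' : list {a | P a}, forall x, In (proj1_sig x) L -> In x L'.
Proof.
  induction L as [|a L [L' IH]]; [now exists nil|].
  destruct (classic (P a)) as [Ha|Ha].
  - exists (exist P a Ha :: L'). intros x [E|Hx]; [left; now apply sig_eq|right; auto].
  - exists L'. intros [x Px] [E|Hx]; [destruct Ha; simpl in E; now subst|auto].
Qed.

Lemma aV_inv (H : grp) (K : Hcomplex H) h x : aV K (ginv H h) (aV K h x) = x.
Proof. now rewrite <- aVM, gmulV, aV1. Qed.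

Section Build.
Variable H : grp.
Variable X : Hcomplex H.
Variable V : Type.
Variable phi : V -> cV X.
Variable T : V -> cD X -> V.
Hypothesis T_rev : forall v d, phi v = src d -> T (T v d) (rev d) = v.
Variable act : H -> V -> V.
Hypothesis act1 : forall v, act (gone H) v = v.
Hypothesis actM : forall a b v, act (gmul H a b) v = act a (act b v).
Hypothesis phi_act : forall a v, phi (act a v) = aV X a (phi v).
Hypothesis T_act : forall a v d, T (act a v) (aD X a d) = act a (T v d).

Definition dact (a : H) (e : V * cD X) : V * cD X := (act a (fst e), aD X a (snd e)).
Definition pact (a : H) (p : pos X V) : pos X V := (act a (fst p), aC X a (snd p)).

Lemma dact1 e : dact (gone H) e = e.
Proof. destruct e. unfold dact; simpl. now rewrite act1, aD1. Qed.
Lemma pact1 p : pact (gone H) p = p.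
Proof. destruct p. unfold pact; simpl. now rewrite act1, aC1. Qed.
Lemma dactM a b e : dact (gmul H a b) e = dact a (dact b e).
Proof. unfold dact; simpl. now rewrite actM, aDM. Qed.
Lemma pactM a b p : pact (gmul H a b) p = pact a (pact b p).
Proof. unfold pact; simpl. now rewrite actM, aCM. Qed.
Lemma dact_inv a e : dact (ginv H a) (dact a e) = e.
Proof. now rewrite <- dactM, gmulV, dact1. Qed.
Lemma pact_inv a p : pact (ginv H a) (pact a p) = p.
Proof. now rewrite <- pactM, gmulV, pact1. Qed.

Lemma pdart_act a p : pdart (pact a p) = dact a (pdart p).
Proof. unfold pdart, pact, dact; simpl. now rewrite a_dart. Qed.
Lemma drev_act a e : drev T (dact a e) = dact a (drev T e).
Proof. unfold drev, dact; simpl. now rewrite T_act, a_rev. Qed.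
Lemma pnext_act a p : pnext T (pact a p) = pact a (pnext T p).
Proof. unfold pnext, pact; simpl. now rewrite a_dart, T_act, a_next. Qed.
Lemma pflip_act a p : pflip T (pact a p) = pact a (pflip T p).
Proof. unfold pflip, pact; simpl. now rewrite a_dart, T_act, a_flip. Qed.

Lemma reach_act a p q : reach T p q -> reach T (pact a p) (pact a q).
Proof.
  induction 1 as [|q Hq IH|q Hq IH]; [constructor| |].
  - rewrite <- pnext_act. now apply reach_next.
  - rewrite <- pflip_act. now apply reach_flip.
Qed.

Lemma walk_act a v l : walk T (act a v) (map (aD X a) l) = act a (walk T v l).
Proof.
  revert v; induction l as [|d l IH]; intro v; [easy|]. simpl. now rewrite T_act, IH.
Qed.

Lemma map_bword_act a (c : cC X) k : map (aD X a) (bword c k) = bword (aC X a c) k.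
Proof.
  revert c; induction k as [|k IH]; intro c; [easy|].
  now rewrite !bword_S, <- a_next, <- IH, a_dart.
Qed.

Variables (VP : V -> Prop) (DP : V * cD X -> Prop) (CP : pos X V -> Prop).
Hypothesis G : good phi T DP CP.
Hypothesis VP_dp : forall e, DP e -> VP (fst e).
Hypothesis VP_act : forall a v, VP v -> VP (act a v).
Hypothesis DP_act : forall a e, DP e -> DP (dact a e).
Hypothesis CP_act : forall a p, CP p -> CP (pact a p).

(** The quotient of positions by [reach] is represented by canonical elements: a 2-cell of the
    complex is a position fixed by [frep]. *)
Definition frep (p : pos X V) : pos X V := epsilon (inhabits p) (reach T p).

Lemma frep_reach p : reach T p (frep p).
Proof. apply (epsilon_spec (inhabits p) (reach T p)). exists p. constructor. Qed.

Lemma frep_eq p q : CP p -> reach T p q -> frep p = frep q.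
Proof.
  intros Hp Hr. unfold frep. f_equal; [apply proof_irrelevance|].
  apply functional_extensionality. intro r. apply propositional_extensionality.
  assert (Hq := reach_sym T_rev G Hp Hr).
  split; intro; eapply reach_trans; eassumption.
Qed.

Lemma frep_cp p : CP p -> CP (frep p) /\ frep (frep p) = frep p.
Proof.
  intro Hp. split; [exact (reach_cp G Hp (frep_reach p))|].
  symmetry. apply frep_eq; [easy|]. apply frep_reach.
Qed.

Lemma frep_inv p q : CP p -> CP q -> frep p = frep q -> reach T p q.
Proof.
  intros Hp Hq E. apply reach_trans with (frep p); [apply frep_reach|].
  rewrite E. apply (reach_sym T_rev G Hq), frep_reach.
Qed.

Let ZV := {v | VP v}.
Let ZD := {e | DP e}.
Let ZC := {p | CP p}.
Let ZF := {p | CP p /\ frep p = p}.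

Lemma VP_src (e : ZD) : VP (fst (proj1_sig e)).
Proof. apply VP_dp, proj2_sig. Qed.

Definition z_src (e : ZD) : ZV := exist VP _ (VP_src e).
Definition z_rev (e : ZD) : ZD := exist DP _ (dp_rev G _ (proj2_sig e)).
Definition z_face (p : ZC) : ZF := exist _ _ (frep_cp (proj2_sig p)).
Definition z_dart (p : ZC) : ZD := exist DP _ (cp_dp G _ (proj2_sig p)).
Definition z_next (p : ZC) : ZC := exist CP _ (cp_next G _ (proj2_sig p)).
Definition z_flip (p : ZC) : ZC := exist CP _ (cp_flip G _ (proj2_sig p)).

Lemma z_iter k p : proj1_sig (Nat.iter k z_next p) = Nat.iter k (pnext T) (proj1_sig p).
Proof. induction k as [|k IH]; simpl; [easy|]. now rewrite IH. Qed.

Definition z_complex : complex.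
Proof.
  refine (@Complex ZV ZD ZF ZC z_src z_rev _ _ z_face z_dart z_next z_flip _ _ _ _ _ _ _ _ _ _).
  - intros [e He]. apply sig_eq; simpl. exact (drev_invol T_rev G He).
  - intros [e He] E. apply (f_equal (fun x => snd (proj1_sig x))) in E. simpl in E.
    now apply rev_nofix in E.
  - intros [p Hp]. now apply sig_eq.
  - intros [p Hp]. apply sig_eq; simpl. symmetry. apply frep_eq; [easy|].
    apply reach_next, reach_refl.
  - intros [p Hp]. apply sig_eq; simpl. exact (pflip_invol T_rev G Hp).
  - intros [p Hp]. apply sig_eq; simpl. symmetry. apply frep_eq; [easy|].
    apply reach_flip, reach_refl.
  - intros [p Hp]. apply sig_eq; simpl. apply pdart_flip.
  - intros [p Hp]. apply sig_eq; simpl. exact (pnext_flip_next T_rev G Hp).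
  - intros [p Hp]. destruct (cycle_finite _ (snd p)) as (k & Hk & Ek).
    exists k. split; [easy|]. apply sig_eq. rewrite z_iter. now apply (pnext_period G).
  - intros [p Hp] k E. apply (f_equal (fun x => snd (proj1_sig x))) in E.
    rewrite z_iter, iter_pnext in E. simpl in E. now apply orient_disj in E.
  - intros [p Hp] [q Hq] E. apply (f_equal (@proj1_sig _ _)) in E. simpl in E.
    apply frep_inv in E; [|easy..].
    destruct (reach_inv T_rev G Hp E) as [k [Ek|Ek]]; exists k; [left|right];
      apply sig_eq; now rewrite z_iter.
  - intros [p [Hp E]]. exists (exist _ p Hp). now apply sig_eq.
Defined.

Definition z_aV (a : H) (v : ZV) : ZV := exist VP _ (VP_act a (proj2_sig v)).
Definition z_aD (a : H) (e : ZD) : ZD := exist DP _ (DP_act a (proj2_sig e)).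
Definition z_aC (a : H) (p : ZC) : ZC := exist CP _ (CP_act a (proj2_sig p)).
Definition z_aF (a : H) (p : ZF) : ZF := exist _ _ (frep_cp (CP_act a (proj1 (proj2_sig p)))).

Definition z_hcomplex : Hcomplex H.
Proof.
  refine (@HComplex H z_complex z_aV z_aD z_aF z_aC _ _ _ _ _ _ _ _ _ _ _ _ _ _ _).
  - intros [v Hv]. apply sig_eq, act1.
  - intros [v Hv]. apply sig_eq, dact1.
  - intros [p [Hp E]]. apply sig_eq; simpl. now rewrite pact1.
  - intros [v Hv]. apply sig_eq, pact1.
  - intros a b [v Hv]. apply sig_eq, actM.
  - intros a b [v Hv]. apply sig_eq, dactM.
  - intros a b [p [Hp E]]. apply sig_eq; simpl. rewrite pactM.
    apply frep_eq; [now apply CP_act, CP_act|]. apply reach_act, frep_reach.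
  - intros a b [v Hv]. apply sig_eq, pactM.
  - intros a [e He]. apply sig_eq; reflexivity.
  - intros a [e He]. apply sig_eq; simpl. symmetry. apply drev_act.
  - intros a [p Hp]. apply sig_eq; simpl. 
    apply frep_eq; [now apply CP_act|]. apply reach_act, frep_reach.
  - intros a [p Hp]. apply sig_eq, pdart_act.
  - intros a [p Hp]. apply sig_eq; simpl. symmetry. apply pnext_act.
  - intros a [p Hp]. apply sig_eq; simpl. symmetry. apply pflip_act.
  - intros a [e He] E. apply (f_equal (fun x => snd (proj1_sig x))) in E. simpl in E.
    now apply no_inversion in E.
Defined.

Definition z_hom : hom z_hcomplex X.
Proof.
  refine (@Hom z_complex X (fun v : ZV => phi (proj1_sig v)) (fun e : ZD => snd (proj1_sig e))
    (fun p : ZF => cface (snd (proj1_sig p))) (fun p : ZC => snd (proj1_sig p)) _ _ _ _ _ _ _).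
  - intros [e He]. symmetry. exact (dp_src G _ He).
  - easy.
  - intros [p Hp]. symmetry. exact (reach_face (frep_reach p)).
  - easy.
  - easy.
  - easy.
  - intros [p Hp] [q Hq] E1 E2. apply (f_equal (@proj1_sig _ _)) in E1. simpl in *.
    apply frep_inv in E1; [|easy..]. apply sig_eq. exact (reach_snd_inj T_rev G Hp E1 E2).
Defined.

Lemma z_hom_equivariant : equivariant z_hom.
Proof.
  repeat split.
  - intros a [v Hv]. apply phi_act.
  - intros a [p Hp]. simpl. rewrite <- a_face. 
    exact (reach_face (frep_reach (pact a p))).
Qed.

(** A dart is a 0-cell together with a dart of [X], so local injectivity on darts is built in. A
    position is recovered, through its flip, from its far end and its image; this settles both
    alternatives of [same_corner]. *)
Lemma z_hom_immersion : immersion z_hom.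
Proof.
  assert (P : forall p q : ZC, fst (pnext T (proj1_sig p)) = fst (pnext T (proj1_sig q)) ->
     snd (proj1_sig p) = snd (proj1_sig q) -> p = q).
  { intros [p Hp] [q Hq] E1 E2. simpl in *. apply sig_eq; simpl.
    assert (F := pflip_invol T_rev G Hp). rewrite <- F, <- (pflip_invol T_rev G Hq).
    f_equal. destruct p, q; unfold pflip; simpl in *. now rewrite E1, E2. }
  split.
  - intros [[v d] He] [[v' d'] He'] E1 E2. simpl in *.
    apply (f_equal (@proj1_sig _ _)) in E1. simpl in E1. apply sig_eq; simpl. now subst.
  - intros p q E1 E2. apply (f_equal (@proj1_sig _ _)) in E1. simpl in E1.
    destruct E2 as [E2|E2]; simpl in E2.
    + left. apply P; [now symmetry|easy].
    + right. apply P; [|easy]. simpl. rewrite <- E1. destruct p as [p Hp]. simpl.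
      rewrite cflip_dart. symmetry. 
      exact (T_back T_rev G (cp_dp G _ (cp_next G _ Hp))).
Qed.

(** * Words of [X] and their homotopies as paths and homotopies of the complex *)

Definition unlift (L : list ZD) : list (cD X) := map (fun e => snd (proj1_sig e)) L.

Lemma z_lift (u : ZV) l : wvalid T DP (proj1_sig u) l ->
  exists L : list (cD z_hcomplex), chain (K := z_hcomplex) u L /\ unlift L = l.
Proof.
  revert u; induction l as [|d l IH]; intros u Hl; [now exists nil|].
  destruct Hl as [Hd Hl].
  set (e := exist DP _ Hd : ZD).
  destruct (IH (@tgt z_hcomplex e)) as (L & HL & EL); [exact Hl|].
  exists (e :: L). split; [split; [now apply sig_eq|easy]|]. simpl. now rewrite EL.
Qed.

Lemma z_chain (u : ZV) (L : list ZD) : chain (K := z_hcomplex) u L ->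
  wvalid T DP (proj1_sig u) (unlift L) /\
  proj1_sig (pend (K := z_hcomplex) u L) = walk T (proj1_sig u) (unlift L).
Proof.
  revert u; induction L as [|e L IH]; intros u HL; [easy|].
  destruct HL as [E HL]. destruct (IH _ HL) as [A1 A2]. subst u. simpl.
  destruct e as [[v d] He]. simpl in *. tauto.
Qed.

Lemma z_lift_inj (u : ZV) (L L' : list ZD) :
  chain (K := z_hcomplex) u L -> chain (K := z_hcomplex) u L' -> unlift L = unlift L' -> L = L'.
Proof.
  revert u L'; induction L as [|e L IH]; intros u [|e' L'] HL HL' E; try easy.
  destruct HL as [E1 HL], HL' as [E2 HL']. injection E as Ed El.
  assert (e = e').
  { subst u. apply (f_equal (@proj1_sig _ _)) in E2. simpl in E2.
    destruct e as [[v d] He], e' as [[v' d'] He']. simpl in *. apply sig_eq. simpl. now subst. }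
  subst e'. f_equal. now apply IH with (tgt (K := z_hcomplex) e).
Qed.

Lemma unlift_bword (c : ZC) k : unlift (@bword z_hcomplex c k) = bword (snd (proj1_sig c)) k.
Proof. exact (map_bword z_hom c k). Qed.

Lemma z_hstep (u : ZV) (L L' : list ZD) :
  chain (K := z_hcomplex) u L -> chain (K := z_hcomplex) u L' ->
  wstep T DP CP (proj1_sig u) (unlift L) (unlift L') -> @hstep z_hcomplex u L L'.
Proof.
  intros HL HL' (l1 & l2 & E' & Hs).
  assert (S : forall M a b, unlift M = a ++ b -> exists M1 M2, M = M1 ++ M2 /\ unlift M1 = a /\ unlift M2 = b).
  { induction M as [|x M IH]; intros a b E; simpl in E.
    - symmetry in E. apply app_eq_nil in E as [-> ->]. now exists nil, nil.
    - destruct a as [|y a]; [now exists nil, (x :: M)|]. injection E as Ex Em.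
      destruct (IH _ _ Em) as (M1 & M2 & -> & <- & <-). exists (x :: M1), M2. now subst y. }
  destruct (S _ _ _ E') as (L1 & L2 & -> & <- & <-).
  apply chain_app in HL' as [H1 H2]. exists L1, L2. split; [easy|].
  assert (HL1 := z_chain _ _ H1).
  inversion Hs as [d Hd El|c k Hk Ek Hc El].
  - left. set (e := exist DP _ Hd : ZD). exists e.
    assert (Es : @src z_hcomplex e = @pend z_hcomplex u L1) by (apply sig_eq; symmetry; apply HL1).
    split; [easy|].
    apply (@z_lift_inj u); [easy| |].
    + apply chain_app. split; [easy|]. split; [easy|]. split; [easy|].
      rewrite (tgt_rev z_hcomplex e). now rewrite Es.
    + rewrite <- El. unfold unlift. rewrite map_app. reflexivity.
  - right. set (C := exist CP _ Hc : ZC). exists C, k.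
    assert (Es : @src z_hcomplex (@cdart z_hcomplex C) = @pend z_hcomplex u L1)
      by (apply sig_eq; symmetry; apply HL1).
    assert (EC : Nat.iter k (@cnext z_hcomplex) C = C).
    { apply sig_eq. change (@cnext z_hcomplex) with z_next. rewrite z_iter.
      now apply (pnext_period G). }
    repeat split; [easy..|].
    apply (@z_lift_inj u); [easy| |].
    + apply chain_app. split; [easy|]. rewrite <- Es.
      apply chain_app. destruct (@chain_bword z_hcomplex C k) as [B1 B2]. split; [easy|].
      rewrite B2, EC, Es. easy.
    + rewrite <- El. unfold unlift. rewrite !map_app. do 2 f_equal. symmetry.
      exact (unlift_bword C k).
Qed.

(** Intermediate words remain valid by [whomot_valid], hence lift to intermediate paths; the lift
    from a given 0-cell is unique. *)
Lemma z_homotopic (u : ZV) l l' : whomot T DP CP (proj1_sig u) l l' ->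
  forall L L', chain (K := z_hcomplex) u L -> chain (K := z_hcomplex) u L' ->
  unlift L = l -> unlift L' = l' -> @homotopic z_hcomplex u L L'.
Proof.
  intro Hh. induction Hh as [l l' Hs|l|l l' Hh IH|l m l' H1 IH1 H2 IH2]; intros L L' HL HL' E E'.
  - apply rst_step. subst. now apply z_hstep.
  - rewrite (@z_lift_inj u L L'); [apply rst_refl|easy|easy|now subst].
  - apply rst_sym. now apply IH.
  - assert (Hm : wvalid T DP (proj1_sig u) m).
    { apply (whomot_valid T_rev G H1). subst l. now apply z_chain. }
    destruct (z_lift u m Hm) as (M & HM & EM).
    eapply rst_trans; [exact (IH1 L M HL HM E EM)|exact (IH2 M L' HM HL' EM E')].
Qed.

End Build.

(** * Iterated deletion *)

Section Core.
Variable H : grp.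
Variable X : Hcomplex H.
Variable V : Type.
Variable phi : V -> cV X.
Variable T : V -> cD X -> V.
Hypothesis T_rev : forall v d, phi v = src d -> T (T v d) (rev d) = v.
Variable act : H -> V -> V.
Hypothesis act1 : forall v, act (gone H) v = v.
Hypothesis actM : forall a b v, act (gmul H a b) v = act a (act b v).
Hypothesis T_act : forall a v d, T (act a v) (aD X a d) = act a (T v d).

(** [DY] and [CY] mark the darts and positions that come from [Y], [W i] the words of loops of [Y] at the
    0-cell [i], and [wP] is the word, read from [vP], of the path to be contracted. *)
Variable DY : V * cD X -> Prop.
Hypothesis DY_rev : forall e, DY e -> DY (drev T e).
Hypothesis DY_act : forall a e, DY e -> DY (dact X act a e).
Variable CY : pos X V -> Prop.
Hypothesis CY_next : forall p, CY p -> CY (pnext T p).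
Hypothesis CY_flip : forall p, CY p -> CY (pflip T p).
Hypothesis CY_dart : forall p, CY p -> DY (pdart p).
Variables (I : Type) (base : I -> V).
Variable W : I -> list (cD X) -> Prop.
Hypothesis W_valid : forall i l, W i l -> wvalid T DY (base i) l.
Variables (vP : V) (wP : list (cD X)).
Hypothesis wP_valid : wvalid T DY vP wP.

Record admissible (DP : V * cD X -> Prop) (CP : pos X V -> Prop) : Prop := Admissible {
  adm_good : good phi T DP CP;
  adm_DY : forall e, DY e -> DP e;
  adm_CY : forall p, CY p -> CP p;
  adm_dact : forall a e, DP e -> DP (dact X act a e);
  adm_pact : forall a p, CP p -> CP (pact X act a p);
  adm_surj : forall i m, wvalid T DP (base i) m -> walk T (base i) m = base i ->
    exists l, W i l /\ whomot T DP CP (base i) l m;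
  adm_null : whomot T DP CP vP wP nil }.

(** Positions on [e] correspond to corner-ends at the link vertex [e], so this says that its valence
    is at most one. *)
Definition thin (CP : pos X V -> Prop) (e : V * cD X) : Prop :=
  forall p q, CP p -> CP q -> pdart p = e -> pdart q = e -> p = q.

Definition spare DP CP (e : V * cD X) : Prop := DP e /\ ~ DY e /\ thin CP e.

Lemma thin_drev DP CP e : good phi T DP CP -> DP e -> thin CP e -> thin CP (drev T e).
Proof.
  intros G He Ht p q Hp Hq Ep Eq.
  rewrite <- (pflip_invol T_rev G Hp), <- (pflip_invol T_rev G Hq). f_equal.
  apply Ht; [exact (cp_flip G _ Hp)|exact (cp_flip G _ Hq)| |];
    rewrite pdart_flip, ?Ep, ?Eq; exact (drev_invol T_rev G He).
Qed.

Lemma spare_rev DP CP e : good phi T DP CP -> spare DP CP e -> spare DP CP (drev T e).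
Proof.
  intros G (He & Hn & Ht). split; [exact (dp_rev G _ He)|]. split.
  - intro N. apply Hn. rewrite <- (drev_invol T_rev G He). now apply DY_rev.
  - eapply thin_drev; eassumption.
Qed.

Lemma spare_act DP CP a e : admissible DP CP -> spare DP CP e -> spare DP CP (dact X act a e).
Proof.
  intros A (He & Hn & Ht). split; [now apply (adm_dact A)|]. split.
  - intro N. apply Hn. rewrite <- (dact_inv X act act1 actM a e). now apply DY_act.
  - intros p q Hp Hq Ep Eq.
    assert (J : forall r, pact X act a (pact X act (ginv H a) r) = r).
    { intro r. rewrite <- (pact_inv X act act1 actM (ginv H a) (pact X act a _)).
      now rewrite (pact_inv X act act1 actM a), (pact_inv X act act1 actM (ginv H a)). }
    rewrite <- (J p), <- (J q). f_equal.
    apply Ht; [now apply (adm_pact A)..| |]; rewrite pdart_act, ?Ep, ?Eq;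
      apply (dact_inv X act act1 actM).
Qed.

(** All spare darts go at once, which keeps the result [H]-invariant. Words of [Y] contain no spare
    dart, so [whomot_del] transports both the surjectivity and the null-homotopy. *)
Lemma admissible_del DP CP : admissible DP CP ->
  admissible (dp_del DP (spare DP CP)) (cp_del T CP (spare DP CP)).
Proof.
  intro A. assert (G := adm_good A).
  assert (Er : forall e, spare DP CP e -> spare DP CP (drev T e))
    by (intros e; now apply spare_rev).
  assert (Et : forall p q, CP p -> CP q -> spare DP CP (pdart p) -> pdart p = pdart q -> p = q)
    by (intros p q Hp Hq (_ & _ & Ht) E; now apply Ht).
  assert (HY : forall e, DY e -> dp_del DP (spare DP CP) e)
    by (intros e He; split; [now apply (adm_DY A)|now intros (_ & N & _)]).
  assert (Ei : forall a e, spare DP CP (dact X act a e) -> spare DP CP e).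
  { intros a e He. rewrite <- (dact_inv X act act1 actM a e). now apply spare_act. }
  split.
  - now apply good_del.
  - easy.
  - intros p Hp. split; [now apply (adm_CY A)|]. intros q Hq (_ & N & _).
    apply N, CY_dart. clear N. induction Hq; auto.
  - intros a e [He Hn]. split; [now apply (adm_dact A)|]. intro N. apply Hn. exact (Ei _ _ N).
  - intros a p [Hp Hn]. split; [now apply (adm_pact A)|]. intros q Hq Hs.
    apply (Hn (pact X act (ginv H a) q)).
    + rewrite <- (pact_inv X act act1 actM a p). now apply reach_act.
    + rewrite pdart_act. now apply spare_act.
  - intros i m Hm Em.
    destruct (adm_surj A (i := i) m) as (l & Hl & Hh); [|easy|].
    + apply wvalid_mono with (2 := Hm). now intros e [He _].
    + exists l. split; [easy|]. apply (whomot_del T_rev G _ Er Et); [|easy|easy].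
      apply wvalid_mono with (2 := W_valid Hl). easy.
  - apply (whomot_del T_rev G _ Er Et); [|easy|exact (adm_null A)].
    apply wvalid_mono with (2 := wP_valid). easy.
Qed.

Definition covers (L : list (V * cD X)) (DP : V * cD X -> Prop) : Prop :=
  forall e, DP e -> DY e \/ exists a e', In e' L /\ e = dact X act a e'.

(** Being spare is constant on [H]-orbits, so deleting a spare dart also removes its representative
    from [L]; the length of [L] bounds the number of rounds. *)
Lemma core_covered n L DP CP : length L <= n -> covers L DP -> admissible DP CP ->
  exists DP' CP', admissible DP' CP' /\ (forall e, DP' e -> DP e) /\
    (forall p, CP' p -> CP p) /\ forall e, DP' e -> thin CP' e -> DY e.
Proof.
  revert L DP CP; induction n as [n IH] using (well_founded_induction lt_wf).
  intros L DP CP Hn HL A.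
  destruct (classic (exists e, spare DP CP e)) as [[e0 He0]|N].
  2: { exists DP, CP. do 3 (split; [easy|]). intros e He Ht.
       apply NNPP. intro Hd. apply N. now exists e. }
  set (keep := fun e => if excluded_middle_informative (spare DP CP e) then false else true).
  assert (Ei : forall a e, spare DP CP (dact X act a e) -> spare DP CP e).
  { intros a e He. rewrite <- (dact_inv X act act1 actM a e). now apply spare_act. }
  assert (Hlt : length (filter keep L) < length L).
  { destruct (HL e0 (proj1 He0)) as [Hd|(a & e1 & H1 & E1)]; [now destruct He0 as (_ & Hd' & _)|].
    assert (S1 : spare DP CP e1) by (apply (Ei a); now rewrite <- E1).
    apply in_split in H1 as (L1 & L2 & ->). rewrite filter_app, !length_app. simpl.
    replace (keep e1) with false.
    - assert (F := filter_length_le keep L1). assert (F' := filter_length_le keep L2). lia.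
    - unfold keep. now destruct (excluded_middle_informative _). }
  destruct (IH (length (filter keep L))) with (L := filter keep L)
    (DP := dp_del DP (spare DP CP)) (CP := cp_del T CP (spare DP CP))
    as (DP' & CP' & A' & HD & HC & Ht).
  - lia.
  - easy.
  - intros e [He Hs]. destruct (HL e He) as [Hd|(a & e1 & H1 & E1)]; [now left|right].
    exists a, e1. split; [|easy]. apply filter_In. split; [easy|]. unfold keep.
    destruct (excluded_middle_informative _) as [S1|_]; [|easy].
    destruct Hs. rewrite E1. now apply spare_act.
  - now apply admissible_del.
  - exists DP', CP'. split; [easy|]. split; [|split; [|easy]].
    + intros e He. now apply HD.
    + intros p Hp. now apply HC.
Qed.

(** A dart on no 2-cell is vacuously thin. One deletion therefore leaves, outside [Y], only darts
    that carry a position, and these are translates of darts from [LC]. *)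
Lemma core DP CP LC : admissible DP CP ->
  (forall p, CP p -> DY (pdart p) \/ exists a q, In q LC /\ p = pact X act a q) ->
  exists DP' CP', admissible DP' CP' /\ covers (map (@pdart X V) LC) DP' /\
    (forall p, CP' p -> CP p) /\ forall e, DP' e -> thin CP' e -> DY e.
Proof.
  intros A HC. set (DP1 := dp_del DP (spare DP CP)).
  assert (HL : covers (map (@pdart X V) LC) DP1).
  { intros e [He Hs]. destruct (classic (DY e)) as [Hd|Hd]; [now left|].
    destruct (classic (exists p, CP p /\ pdart p = e)) as [(p & Hp & <-)|N].
    - destruct (HC p Hp) as [Hd'|(a & q & Hq & ->)]; [easy|right].
      exists a, (pdart q). split; [now apply in_map|apply pdart_act].
    - destruct Hs. split; [easy|]. split; [easy|]. intros p q Hp _ Ep. destruct N. now exists p. }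
  destruct (@core_covered _ _ DP1 (cp_del T CP (spare DP CP)) (le_n _) HL)
    as (DP' & CP' & A' & H1 & H2 & H3); [now apply admissible_del|].
  exists DP', CP'. split; [easy|]. split; [intros e He; now apply HL, H1|].
  split; [|easy]. intros p Hp. now apply H2.
Qed.

End Core.

(** * Null-homotopies use finitely many 2-cells *)

(** A pair in [A] records a 2-cell move by the prefix at whose end it happens and the position from
    which the boundary is read. Backtracking is left unrestricted, since every dart will be
    available at every 0-cell of the complex to be glued. *)
Definition hstep_in {K : complex} (A : list (list (cD K) * cC K)) (v : cV K)
    (l l' : list (cD K)) : Prop :=
  exists l1 l2, l' = l1 ++ l2 /\
   ((exists d, src d = pend v l1 /\ l = l1 ++ d :: rev d :: l2) \/
    (exists c k, In (l1, c) A /\ 0 < k /\ Nat.iter k cnext c = c /\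
       src (cdart c) = pend v l1 /\ l = l1 ++ bword c k ++ l2)).

Lemma hstep_in_mono (K : complex) (A A' : list (list (cD K) * cC K)) v l l' :
  incl A A' -> clos_refl_sym_trans _ (hstep_in A v) l l' ->
  clos_refl_sym_trans _ (hstep_in A' v) l l'.
Proof.
  intro HA. induction 1 as [l l' (l1 & l2 & E & [Hd|(c & k & Hc & Hr)])|l|l l' Hr IH|l m l' H1 IH1 H2 IH2].
  - apply rst_step. exists l1, l2. tauto.
  - apply rst_step. exists l1, l2. split; [easy|]. right. exists c, k. split; [now apply HA|easy].
  - apply rst_refl.
  - now apply rst_sym.
  - eapply rst_trans; eassumption.
Qed.

Lemma homotopic_finite (K : complex) (v : cV K) l l' : homotopic v l l' ->
  exists A, clos_refl_sym_trans _ (hstep_in A v) l l'.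
Proof.
  induction 1 as [l l' (l1 & l2 & E & [Hd|(c & k & Hr)])|l|l l' Hr [A IH]|l m l' H1 [A1 IH1] H2 [A2 IH2]].
  - exists nil. apply rst_step. exists l1, l2. tauto.
  - exists [(l1, c)]. apply rst_step. exists l1, l2. split; [easy|]. right. exists c, k.
    split; [now left|easy].
  - exists nil. apply rst_refl.
  - exists A. now apply rst_sym.
  - exists (A1 ++ A2). apply rst_trans with m.
    + apply hstep_in_mono with (2 := IH1). now apply incl_appl, incl_refl.
    + apply hstep_in_mono with (2 := IH2). now apply incl_appr, incl_refl.
Qed.

Lemma chain_map (K L : complex) (f : hom K L) v l :
  chain v l -> chain (fV f v) (map (fD f) l).
Proof.
  revert v; induction l as [|d l IH]; intros v Hl; [easy|]. destruct Hl as [E Hl].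
  split; [rewrite f_src; now f_equal|]. unfold tgt. rewrite <- f_rev, f_src. now apply IH.
Qed.

Lemma pend_map (K L : complex) (f : hom K L) v l :
  pend (fV f v) (map (fD f) l) = fV f (pend v l).
Proof.
  revert v; induction l as [|d l IH]; intros v; [easy|]. simpl. rewrite <- IH.
  unfold tgt. now rewrite <- f_rev, f_src.
Qed.

Lemma map_winv (K L : complex) (f : hom K L) l : map (fD f) (winv l) = winv (map (fD f) l).
Proof.
  induction l as [|d l IH]; [easy|]. simpl map. rewrite !winv_cons, map_app, IH. simpl.
  now rewrite f_rev.
Qed.

Lemma chain_winv (K : complex) (v : cV K) l : chain v l ->
  chain (pend v l) (winv l) /\ pend (pend v l) (winv l) = v.
Proof.
  revert v; induction l as [|d l IH]; intros v Hl; [easy|]. destruct Hl as [E Hl].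
  rewrite winv_cons, chain_app, pend_app. destruct (IH _ Hl) as [A1 A2]. simpl.
  rewrite A2, tgt_rev. easy.
Qed.

Lemma pend_act (H : grp) (K : Hcomplex H) a (v : cV K) l :
  pend (aV K a v) (map (aD K a) l) = aV K a (pend v l).
Proof.
  revert v; induction l as [|d l IH]; intros v; [easy|]. simpl. rewrite <- IH.
  unfold tgt. now rewrite <- a_rev, a_src.
Qed.

Lemma iter_act (H : grp) (K : Hcomplex H) a (c : cC K) k :
  aC K a (Nat.iter k cnext c) = Nat.iter k cnext (aC K a c).
Proof. induction k as [|k IH]; simpl; [easy|]. now rewrite a_next, IH. Qed.

Lemma aC_inj (H : grp) (K : Hcomplex H) a (c c' : cC K) : aC K a c = aC K a c' -> c = c'.
Proof.
  intro E. rewrite <- (aC1 _ c), <- (aC1 _ c'), <- (gmulV H a), !aCM. now rewrite E.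
Qed.

(** Corners forget orientation. Flipping moves the common source to a common target, where immersion
    applies; the alternative in which the corner is read the other way contradicts [orient_disj]. *)
Lemma immersion_positions (K L : complex) (f : hom K L) : immersion f ->
  forall c1 c2, src (cdart c1) = src (cdart c2) -> fC f c1 = fC f c2 -> c1 = c2.
Proof.
  intros [_ I] c1 c2 E1 E2.
  destruct (I (cflip c1) (cflip c2)) as [E|E].
  - unfold tgt. now rewrite !cflip_dart, !rev_inv.
  - left. now rewrite !f_flip, E2.
  - symmetry. now apply cflip_inj.
  - apply cflip_inj in E. subst c2. rewrite f_next, f_flip in E2.
    destruct (@orient_disj _ (cflip (fC f c1)) 1). simpl. now rewrite cflip_inv.
Qed.

Lemma cnext_surj (K : complex) (c : cC K) : exists c', cnext c' = c.
Proof.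
  destruct (cycle_finite _ c) as ([|k] & Hk & Ek); [lia|]. now exists (Nat.iter k cnext c).
Qed.

Lemma cover_sig (H : grp) (S : Type) (ac : H -> S -> S)
    (ac1 : forall x, ac (gone H) x = x) (acM : forall a b x, ac (gmul H a b) x = ac a (ac b x))
    (P : S -> Prop) (acP : forall a x, P x -> P (ac a x)) (L : list S) :
  exists L' : list {x | P x}, forall x : {x | P x},
    (exists a w, In w L /\ proj1_sig x = ac a w) ->
    exists a w, In w L' /\ proj1_sig x = ac a (proj1_sig w).
Proof.
  destruct (list_sig P L) as [L' HL]. exists L'. intros [x Px] (a & w & Hw & E). simpl in *.
  assert (Ew : w = ac (ginv H a) x) by now rewrite E, <- acM, gmulV, ac1.
  assert (Pw : P w) by (rewrite Ew; now apply acP).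
  exists a, (exist P w Pw). split; [now apply HL|easy].
Qed.

(** * Attaching finitely many orbits of 2-cells to [Y] along paths of [X] *)

Section Attach.
Variable H : grp.
Variables X Y : Hcomplex H.
Variable f : hom Y X.
Hypothesis ef : equivariant f.
Variable p0 : cV Y.
Variable A : list (list (cD X) * cC X).

(** [(y, l)] stands for the end of the path over [l] that starts at [y]. *)
Let raw : Type := cV Y * list (cD X).

(** [gs_lift] slides the starting point along a 1-cell of [Y], [gs_back] removes a backtrack, and
    [gs_face] closes the boundary of a translate of an attached 2-cell. Stating the last one for the
    recorded prefix is enough, because [glue_app] carries it to every prefix in the same class. *)
Inductive gstep : raw -> raw -> Prop :=
| gs_lift e l : gstep (src e, fD f e :: l) (tgt e, l)
| gs_back y l1 d l2 : src d = pend (fV f y) l1 -> gstep (y, l1 ++ d :: rev d :: l2) (y, l1 ++ l2)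
| gs_face a l0 c0 k l2 : In (l0, c0) A -> Nat.iter k cnext c0 = c0 ->
    0 < k -> src (cdart c0) = pend (fV f p0) l0 ->
    gstep (aV Y a p0, map (aD X a) l0 ++ bword (aC X a c0) k ++ l2)
          (aV Y a p0, map (aD X a) l0 ++ l2).

Definition glue : raw -> raw -> Prop := clos_refl_sym_trans _ gstep.

Lemma glue_end r s : glue r s -> pend (fV f (fst r)) (snd r) = pend (fV f (fst s)) (snd s).
Proof.
  induction 1 as [r s Hs| | |]; [|easy|easy|congruence].
  destruct Hs as [e l|y l1 d l2 E|a l0 c0 k l2 HA Ek Hk E]; simpl.
  - f_equal. unfold tgt. now rewrite <- f_rev, f_src.
  - rewrite !pend_app. simpl. now rewrite tgt_rev, E.
  - rewrite !pend_app. f_equal. rewrite (proj1 ef), pend_act, <- E, <- a_src, <- a_dart.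
    rewrite (proj2 (chain_bword _ _ _)), <- iter_act. now rewrite Ek.
Qed.

Lemma glue_app r s m : glue r s -> glue (fst r, snd r ++ m) (fst s, snd s ++ m).
Proof.
  induction 1 as [r s Hs|r|r s Hr IH|r t s H1 IH1 H2 IH2].
  - apply rst_step. destruct Hs; simpl; rewrite <- ?app_assoc; simpl; try now constructor.
  - apply rst_refl.
  - now apply rst_sym.
  - eapply rst_trans; eassumption.
Qed.

Definition ract (a : H) (r : raw) : raw := (aV Y a (fst r), map (aD X a) (snd r)).

Lemma glue_act a r s : glue r s -> glue (ract a r) (ract a s).
Proof.
  induction 1 as [r s Hs|r|r s Hr IH|r t s H1 IH1 H2 IH2].
  - apply rst_step. destruct Hs as [e l|y l1 d l2 E|b l0 c0 k l2 HA Ek Hk E]; unfold ract; simpl.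
    + rewrite <- a_src. unfold tgt. rewrite <- a_src, a_rev.
      rewrite <- (proj1 (proj2 ef)). apply gs_lift.
    + rewrite !map_app. simpl. rewrite a_rev. apply gs_back.
      now rewrite (proj1 ef), pend_act, <- E, a_src.
    + rewrite !map_app, map_bword_act, <- aCM, <- aVM.
      replace (map (aD X a) (map (aD X b) l0)) with (map (aD X (gmul H a b)) l0).
      * now apply gs_face.
      * rewrite map_map. apply map_ext. intro. apply aDM.
  - apply rst_refl.
  - now apply rst_sym.
  - eapply rst_trans; eassumption.
Qed.

Definition canon (r : raw) : raw := epsilon (inhabits r) (glue r).

Lemma canon_glue r : glue r (canon r).
Proof. apply (epsilon_spec (inhabits r) (glue r)). exists r. apply rst_refl. Qed.

Lemma canon_eq r s : glue r s -> canon r = canon s.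
Proof.
  intro Hr. unfold canon. f_equal; [apply proof_irrelevance|].
  apply functional_extensionality. intro t. apply propositional_extensionality.
  split; intro; eapply rst_trans; [apply rst_sym; exact Hr|easy|exact Hr|easy].
Qed.

Definition att : Type := {r : raw | canon r = r}.
Definition cls (r : raw) : att := exist _ (canon r) (eq_sym (canon_eq (canon_glue r))).

Lemma cls_eq r s : glue r s -> cls r = cls s.
Proof. intro Hr. apply sig_eq. now apply canon_eq. Qed.

Lemma cls_inv r s : cls r = cls s -> glue r s.
Proof.
  intro E. apply (f_equal (@proj1_sig _ _)) in E. simpl in E.
  eapply rst_trans; [apply canon_glue|]. rewrite E. apply rst_sym, canon_glue.
Qed.

Lemma cls_surj v : exists y l, v = cls (y, l).
Proof.
  destruct v as [[y l] E]. exists y, l. apply sig_eq. now symmetry.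
Qed.

Definition att_over (v : att) : cV X := pend (fV f (fst (proj1_sig v))) (snd (proj1_sig v)).
Definition att_step (v : att) (d : cD X) : att := cls (fst (proj1_sig v), snd (proj1_sig v) ++ [d]).
Definition att_act (a : H) (v : att) : att := cls (ract a (proj1_sig v)).

Lemma att_over_cls y l : att_over (cls (y, l)) = pend (fV f y) l.
Proof. symmetry. exact (glue_end (canon_glue (y, l))). Qed.

Lemma att_step_cls y l d : att_step (cls (y, l)) d = cls (y, l ++ [d]).
Proof. apply cls_eq, rst_sym. exact (glue_app [d] (canon_glue (y, l))). Qed.

Lemma att_act_cls a y l : att_act a (cls (y, l)) = cls (aV Y a y, map (aD X a) l).
Proof. apply cls_eq, rst_sym. exact (glue_act a (canon_glue (y, l))). Qed.

Lemma walk_cls y l m : walk att_step (cls (y, l)) m = cls (y, l ++ m).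
Proof.
  revert l; induction m as [|d m IH]; intro l; [now rewrite app_nil_r|].
  rewrite walk_cons, att_step_cls, IH, <- app_assoc. reflexivity.
Qed.

Lemma att_over_step v d : att_over (att_step v d) = tgt d.
Proof.
  destruct (cls_surj v) as (y & l & ->). rewrite att_step_cls, att_over_cls, pend_app. reflexivity.
Qed.

Lemma att_step_rev v d : att_over v = src d -> att_step (att_step v d) (rev d) = v.
Proof.
  destruct (cls_surj v) as (y & l & ->). rewrite att_over_cls, !att_step_cls. intro E.
  apply cls_eq, rst_step. rewrite <- app_assoc. simpl.
  rewrite <- (app_nil_r l) at 2. now apply gs_back.
Qed.

Lemma att_act1 v : att_act (gone H) v = v.
Proof.
  destruct (cls_surj v) as (y & l & ->). rewrite att_act_cls, aV1. do 2 f_equal.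
  rewrite <- (map_id l) at 2. apply map_ext. apply aD1.
Qed.

Lemma att_actM a b v : att_act (gmul H a b) v = att_act a (att_act b v).
Proof.
  destruct (cls_surj v) as (y & l & ->). rewrite !att_act_cls, aVM, map_map. do 2 f_equal.
  apply map_ext. apply aDM.
Qed.

Lemma att_over_act a v : att_over (att_act a v) = aV X a (att_over v).
Proof.
  destruct (cls_surj v) as (y & l & ->). rewrite att_act_cls, !att_over_cls, (proj1 ef).
  apply pend_act.
Qed.

Lemma att_step_act a v d : att_step (att_act a v) (aD X a d) = att_act a (att_step v d).
Proof.
  destruct (cls_surj v) as (y & l & ->). rewrite att_act_cls, !att_step_cls, att_act_cls, map_app.
  reflexivity.
Qed.

Definition yV (y : cV Y) : att := cls (y, nil).
Definition yD (e : cD Y) : att * cD X := (yV (src e), fD f e).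
Definition yC (c : cC Y) : pos X att := (yV (src (cdart c)), fC f c).

Lemma att_step_yV e : att_step (yV (src e)) (fD f e) = yV (tgt e).
Proof. unfold yV. rewrite att_step_cls. apply cls_eq, rst_step, gs_lift. Qed.

Lemma drev_yD e : drev att_step (yD e) = yD (rev e).
Proof. unfold drev, yD; simpl. now rewrite att_step_yV, f_rev. Qed.

Lemma pdart_yC c : pdart (yC c) = yD (cdart c).
Proof. unfold pdart, yD; simpl. now rewrite f_dart. Qed.

Lemma pnext_yC c : pnext att_step (yC c) = yC (cnext c).
Proof.
  unfold pnext, yC; simpl. rewrite f_dart, att_step_yV, <- f_next, cnext_src. reflexivity.
Qed.

Lemma pflip_yC c : pflip att_step (yC c) = yC (cflip c).
Proof.
  unfold pflip, yC; simpl. rewrite f_dart, att_step_yV, <- f_flip, cflip_tgt. reflexivity.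
Qed.

Lemma iter_yC k c : Nat.iter k (pnext att_step) (yC c) = yC (Nat.iter k cnext c).
Proof. induction k as [|k IH]; simpl; [easy|]. now rewrite IH, pnext_yC. Qed.

Lemma yV_act a y : yV (aV Y a y) = att_act a (yV y).
Proof. unfold yV. now rewrite att_act_cls. Qed.

Lemma yD_act a e : yD (aD Y a e) = dact X att_act a (yD e).
Proof.
  unfold yD, dact; simpl. now rewrite a_src, yV_act, (proj1 (proj2 ef)).
Qed.

Lemma yC_act a c : yC (aC Y a c) = pact X att_act a (yC c).
Proof.
  unfold yC, pact; simpl.
  now rewrite a_dart, a_src, yV_act, (proj2 (proj2 (proj2 ef))).
Qed.

Lemma same_face_reach c c' : cface c = cface c' -> reach att_step (yC c) (yC c').
Proof.
  intro E. destruct (face_conn _ _ _ E) as [k [-> | ->]]; rewrite <- iter_yC.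
  - apply reach_iter.
  - rewrite <- pflip_yC. apply reach_trans with (pflip att_step (yC c)); [|apply reach_iter].
    apply reach_flip, reach_refl.
Qed.

Lemma walk_yV y l : chain y l -> walk att_step (yV y) (map (fD f) l) = yV (pend y l).
Proof.
  revert y; induction l as [|e l IH]; intros y Hl; [easy|]. destruct Hl as [<- Hl].
  simpl map. rewrite walk_cons, att_step_yV. now apply IH.
Qed.

Definition isD (e : att * cD X) : Prop := exists e', e = yD e'.
Definition isC (p : pos X att) : Prop := exists c', p = yC c'.

Lemma valid_yV y l : chain y l -> wvalid att_step isD (yV y) (map (fD f) l).
Proof.
  revert y; induction l as [|e l IH]; intros y Hl; [easy|]. destruct Hl as [<- Hl].
  simpl. split; [now exists e|]. rewrite att_step_yV. now apply IH.
Qed.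

Definition seed (x : list (cD X) * cC X) : pos X att := (cls (p0, fst x), snd x).

Definition att_dart (e : att * cD X) : Prop := att_over (fst e) = src (snd e).
(** The condition on the seed discards entries of [A] whose position does not start where the prefix
    ends. *)
Definition att_pos (p : pos X att) : Prop := isC p \/
  exists a x q, In x A /\ att_dart (pdart (seed x)) /\ reach att_step (seed x) q /\ p = pact X att_act a q.

Lemma att_dart_next p : att_dart (pdart (pnext att_step p)).
Proof. unfold att_dart; simpl. now rewrite att_over_step, cnext_src. Qed.

Lemma att_dart_flip p : att_dart (pdart (pflip att_step p)).
Proof. unfold att_dart; simpl. now rewrite att_over_step, cflip_tgt. Qed.

(** A step always ends over the target of its dart, so whatever arises by [pnext] or [pflip] is
    correctly based. *)
Lemma att_dart_reach p q : att_dart (pdart p) -> reach att_step p q -> att_dart (pdart q).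
Proof. intros Hp [|r Hr|r Hr]; [easy|apply att_dart_next|apply att_dart_flip]. Qed.

Lemma att_dart_act a e : att_dart e -> att_dart (dact X att_act a e).
Proof. unfold att_dart; simpl. intro E. now rewrite att_over_act, E, a_src. Qed.

Lemma att_dart_yD e : att_dart (yD e).
Proof. unfold att_dart, yD, yV; simpl. rewrite att_over_cls. symmetry. apply f_src. Qed.

Let returns (p : pos X att) : Prop :=
  forall k, Nat.iter k cnext (snd p) = snd p -> Nat.iter k (pnext att_step) p = p.

Lemma returns_reach p q : reach att_step p q -> returns p -> returns q.
Proof.
  intros Hr Hp. induction Hr as [|q Hq IH|q Hq IH]; [easy| |]; intros k Ek.
  - simpl in Ek. rewrite <- Nat.iter_succ_r in Ek. apply cnext_inj in Ek.
    rewrite <- Nat.iter_succ_r, Nat.iter_succ. now rewrite IH.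
  - simpl in Ek. apply iter_flip_period in Ek. specialize (IH k Ek).
    (* Writing [q] as its own [k]-th iterate reduces the claim to retracing: [k] steps, a flip and
       [k] more steps give the flip of the start. *)
    rewrite <- IH at 1. generalize q. clear -ef. intro q. induction k as [|k IH]; [easy|].
    rewrite Nat.iter_succ_r, (Nat.iter_succ k _ (pnext att_step) q), <- IH. f_equal.
    destruct (Nat.iter k (pnext att_step) q) as [v c]. unfold pnext, pflip; simpl.
    rewrite cflip_next, cflip_dart. f_equal. apply att_step_rev.
    now rewrite att_over_step, cnext_src.
Qed.

Lemma returns_act a p : returns p -> returns (pact X att_act a p).
Proof.
  intros Hp k Ek. simpl in Ek. rewrite <- iter_act in Ek. apply aC_inj in Ek.
  assert (P : forall k, Nat.iter k (pnext att_step) (pact X att_act a p) = pact X att_act a (Nat.iter k (pnext att_step) p)).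
  { clear -ef. induction k as [|k IH]; [easy|]. simpl. rewrite IH. apply pnext_act, att_step_act. }
  now rewrite P, Hp.
Qed.

Lemma returns_seed x : In x A -> att_dart (pdart (seed x)) -> returns (seed x).
Proof.
  intros Hx HD k Ek. destruct x as [l0 c0]. unfold att_dart in HD. simpl in HD.
  rewrite att_over_cls in HD. destruct k as [|k]; [easy|].
  change (Nat.iter (S k) (pnext att_step) (cls (p0, l0), c0) = (cls (p0, l0), c0)).
  rewrite iter_pnext. cbn [fst snd]. cbn [fst snd seed] in Ek. rewrite Ek, walk_cls.
  f_equal. apply cls_eq, rst_step.
  assert (S := @gs_face (gone H) l0 c0 (S k) nil Hx Ek (Nat.lt_0_succ k) (eq_sym HD)).
  rewrite aV1, aC1, !app_nil_r in S.
  replace (map (aD X (gone H)) l0) with l0 in S; [easy|].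
  rewrite <- (map_id l0) at 1. apply map_ext. intro d. now rewrite aD1.
Qed.

(** On 2-cells of [Y], a period of the image is already a period in [Y], because [f] is injective on
    boundary positions. On attached 2-cells the closing is imposed by [gs_face]. *)
Lemma returns_all p : att_pos p -> returns p.
Proof.
  intros [[c ->]|(a & x & q & Hx & HD & Hr & ->)].
  - intros k Ek. simpl in Ek. rewrite iter_yC. f_equal.
    apply (f_face_inj f); [apply iter_face|]. now rewrite iter_hom.
  - apply returns_act. apply (returns_reach Hr). now apply returns_seed.
Qed.

Lemma good_att : good att_over att_step att_dart att_pos.
Proof.
  split.
  - easy.
  - intros e He. unfold att_dart; simpl. apply att_over_step.
  - intros p [[c ->]|(a & x & q & Hx & HD & Hr & ->)].
    + rewrite pdart_yC. apply att_dart_yD.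
    + rewrite pdart_act. apply att_dart_act. exact (att_dart_reach HD Hr).
  - intros p [[c ->]|(a & x & q & Hx & HD & Hr & ->)].
    + left. exists (cnext c). apply pnext_yC.
    + right. exists a, x, (pnext att_step q). repeat split; [easy|easy|now apply reach_next|].
      apply pnext_act, att_step_act.
  - intros p [[c ->]|(a & x & q & Hx & HD & Hr & ->)].
    + left. exists (cflip c). apply pflip_yC.
    + right. exists a, x, (pflip att_step q). repeat split; [easy|easy|now apply reach_flip|].
      apply pflip_act, att_step_act.
  - intros p k Hp Hk Ek. assert (E := returns_all Hp _ Ek). rewrite iter_pnext in E.
    exact (f_equal fst E).
Qed.

Lemma att_pos_act a p : att_pos p -> att_pos (pact X att_act a p).
Proof.
  intros [[c ->]|(b & x & q & Hx & HD & Hr & ->)].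
  - left. exists (aC Y a c). now rewrite yC_act.
  - right. exists (gmul H a b), x, q. repeat split; [easy..|].
    symmetry. apply pactM, att_actM.
Qed.

Lemma att_pos_finite : exists LC, forall p, att_pos p ->
  isC p \/ exists a q, In q LC /\ p = pact X att_act a q.
Proof.
  assert (P : forall A', incl A' A -> exists LC, forall x q, In x A' ->
     att_dart (pdart (seed x)) -> reach att_step (seed x) q -> In q LC).
  { induction A' as [|x A' IH]; intro HA; [now exists nil|].
    destruct IH as [LC HL]; [intros y Hy; apply HA; now right|].
    destruct (classic (att_dart (pdart (seed x)))) as [HD|HD].
    - assert (Hx : att_pos (seed x)).
      { right. exists (gone H), x, (seed x). repeat split; [apply HA; now left|easy|constructor|].
        symmetry. apply pact1, att_act1. }
      destruct (reach_finite att_step_rev good_att Hx) as [L1 H1]. exists (L1 ++ LC).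
      intros y q [<-|Hy] Hd Hr; apply in_or_app; [left; auto|right; eauto].
    - exists LC. intros y q [<-|Hy] Hd Hr; [easy|eauto]. }
  destruct (P A (incl_refl A)) as [LC HL]. exists LC.
  intros p [Hp|(a & x & q & Hx & HD & Hr & ->)]; [now left|right]. exists a, q. eauto.
Qed.

(** Modulo the attached 2-cells, words can be pushed into [Y]: the free part of the
    construction consists of trees. *)
Lemma glue_path r s : glue r s -> exists q, chain (fst r) q /\ pend (fst r) q = fst s /\
  whomot att_step att_dart att_pos (yV (fst r)) (snd r) (map (fD f) q ++ snd s).
Proof.
  assert (VD : forall y q, chain y q -> wvalid att_step att_dart (yV y) (map (fD f) q)).
  { intros y q Hq. apply wvalid_mono with (2 := valid_yV _ _ Hq).
    intros e [e' ->]. apply att_dart_yD. }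
  induction 1 as [r s Hs|r|r s Hr (q & Hq & Eq & IH)|r t s H1 (q & Hq & Eq & IH) H2 (q' & Hq' & Eq' & IH')].
  - destruct Hs as [e l|y l1 d l2 E|a l0 c0 k l2 HA Ek Hk E]; simpl.
    + exists [e]. repeat split; [apply rst_refl].
    + exists nil. repeat split. apply rst_step. exists l1, l2. split; [easy|]. constructor.
      unfold att_dart, yV; simpl. now rewrite walk_cls, att_over_cls.
    + exists nil. repeat split. apply rst_step. exists (map (aD X a) l0), l2. split; [easy|].
      constructor; [easy|now rewrite <- iter_act, Ek|].
      right. exists a, (l0, c0), (seed (l0, c0)). repeat split; [easy| |constructor|].
      * unfold att_dart; simpl. now rewrite att_over_cls.
      * unfold yV, seed, pact; simpl. now rewrite walk_cls, att_act_cls.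
  - exists nil. repeat split. apply rst_refl.
  - destruct (chain_winv _ _ _ Hq) as [B1 B2]. rewrite Eq in *.
    exists (winv q). repeat split; [easy..|]. rewrite map_winv.
    assert (Hw : walk att_step (yV (fst r)) (map (fD f) q) = yV (fst s)) by now rewrite walk_yV, Eq.
    set (F := map (fD f) q) in *.
    assert (HF : wvalid att_step att_dart (yV (fst r)) F) by now apply VD.
    apply rst_trans with (winv F ++ F ++ snd s).
    + apply rst_sym. rewrite app_assoc.
      apply (whomot_app_r (l := winv F ++ F) (l' := nil) (snd s)).
      rewrite <- Hw. exact (whomot_winv_l att_step_rev good_att HF).
    + apply whomot_app_l. rewrite <- Hw, (walk_winv att_step_rev good_att HF).
      now apply rst_sym.
  - exists (q ++ q'). rewrite chain_app, pend_app, Eq. repeat split; [easy..|].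
    rewrite map_app, <- app_assoc. eapply rst_trans; [exact IH|].
    apply whomot_app_l. now rewrite walk_yV, Eq.
Qed.

Definition loops (y : cV Y) (l : list (cD X)) : Prop :=
  exists q, chain y q /\ pend y q = y /\ l = map (fD f) q.

(** That [m] returns means that [(y, m)] and [(y, nil)] are glued; [glue_path] converts this gluing
    into a loop of [Y]. *)
Lemma att_surj y m : walk att_step (yV y) m = yV y ->
  exists l, loops y l /\ whomot att_step att_dart att_pos (yV y) l m.
Proof.
  intro E. unfold yV in E. rewrite walk_cls in E. apply cls_inv in E.
  destruct (glue_path E) as (q & Hq & Eq & Hh). simpl in *.
  exists (map (fD f) q). split; [now exists q|].
  rewrite app_nil_r in Hh. now apply rst_sym.
Qed.

Lemma att_null l l' : clos_refl_sym_trans _ (hstep_in A (fV f p0)) l l' ->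
  whomot att_step att_dart att_pos (yV p0) l l'.
Proof.
  induction 1 as [l l' (l1 & l2 & -> & [(d & Hd & ->)|(c & k & HA & Hk & Ek & Hc & ->)])| | |].
  - apply rst_step. exists l1, l2. split; [easy|]. constructor.
    unfold att_dart, yV; simpl. now rewrite walk_cls, att_over_cls.
  - apply rst_step. exists l1, l2. split; [easy|]. constructor; [easy..|].
    right. exists (gone H), (l1, c), (seed (l1, c)). repeat split; [easy| |constructor|].
    + unfold att_dart; simpl. now rewrite att_over_cls.
    + rewrite (pact1 X att_act att_act1). unfold yV, seed; simpl. now rewrite walk_cls.
  - apply rst_refl.
  - now apply rst_sym.
  - eapply rst_trans; eassumption.
Qed.


(** * The complex [Z] *)

Hypothesis fi : immersion f.
Variable wP : list (cD Y).
Hypothesis chain_wP : chain p0 wP.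
Variables (DP : att * cD X -> Prop) (CP : pos X att -> Prop).
Hypothesis Adm : admissible X att_over att_step att_act isD isC yV loops (yV p0) (map (fD f) wP) DP CP.

Definition linked (v : att) : Prop :=
  exists y l, wvalid att_step DP (yV y) l /\ walk att_step (yV y) l = v.
Definition zDP (e : att * cD X) : Prop := linked (fst e) /\ DP e.
Definition zCP (p : pos X att) : Prop := linked (fst p) /\ CP p.

Lemma linked_yV y : linked (yV y).
Proof. now exists y, nil. Qed.

Lemma linked_walk v l : linked v -> wvalid att_step DP v l -> linked (walk att_step v l).
Proof.
  intros (y & l0 & H0 & <-) Hl. exists y, (l0 ++ l). now rewrite wvalid_app, walk_app.
Qed.

Lemma linked_T v d : linked v -> DP (v, d) -> linked (att_step v d).
Proof. intros Hv Hd. now apply (@linked_walk v [d]). Qed.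

Lemma linked_act a v : linked v -> linked (att_act a v).
Proof.
  intros (y & l & Hl & <-). exists (aV Y a y), (map (aD X a) l). rewrite yV_act. split.
  - generalize (yV y) Hl. clear Hl. induction l as [|d l IH]; intros v Hl; [easy|].
    destruct Hl as [Hd Hl]. split; [exact (adm_dact Adm a _ Hd)|].
    rewrite att_step_act. now apply IH.
  - apply walk_act, att_step_act.
Qed.

Lemma good_z : good att_over att_step zDP zCP.
Proof.
  assert (G := adm_good Adm). split.
  - intros e [_ He]. exact (dp_src G _ He).
  - intros [v d] [Hv He]. split; [now apply linked_T|exact (dp_rev G _ He)].
  - intros p [Hv Hp]. split; [easy|exact (cp_dp G _ Hp)].
  - intros p [Hv Hp]. split; [|exact (cp_next G _ Hp)].
    apply linked_T; [easy|]. exact (cp_dp G _ Hp).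
  - intros p [Hv Hp]. split; [|exact (cp_flip G _ Hp)].
    apply linked_T; [easy|]. exact (cp_dp G _ Hp).
  - intros p k [_ Hp]. exact (cp_loop G _ Hp).
Qed.

Lemma zDP_linked e : zDP e -> linked (fst e).
Proof. now intros [He _]. Qed.

Lemma zDP_act a e : zDP e -> zDP (dact X att_act a e).
Proof. intros [Hv He]. split; [now apply linked_act|exact (adm_dact Adm a _ He)]. Qed.

Lemma zCP_act a p : zCP p -> zCP (pact X att_act a p).
Proof. intros [Hv Hp]. split; [now apply linked_act|exact (adm_pact Adm a _ Hp)]. Qed.

Lemma zvalid v l : linked v -> wvalid att_step DP v l -> wvalid att_step zDP v l.
Proof.
  revert v; induction l as [|d l IH]; intros v Hv Hl; [easy|]. destruct Hl as [Hd Hl].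
  split; [easy|]. apply IH; [now apply linked_T|easy].
Qed.

(** A homotopy of valid words stays in the component where it starts, so discarding the other
    components costs nothing. *)
Lemma zwhomot v l l' : linked v -> wvalid att_step DP v l -> whomot att_step DP CP v l l' ->
  whomot att_step zDP zCP v l l'.
Proof.
  intros Hv Hl Hh. induction Hh as [l l' (l1 & l2 & -> & Hs)|l|l l' Hh IH|l m l' H1 IH1 H2 IH2].
  - apply rst_step. exists l1, l2. split; [easy|].
    destruct Hs as [d Hd|c k Hk Ek Hc]; apply wvalid_app in Hl as [H1 _];
      (constructor; [easy..|]); (split; [now apply linked_walk|easy]).
  - apply rst_refl.
  - apply rst_sym, IH. now apply (whomot_valid att_step_rev (adm_good Adm) Hh).
  - eapply rst_trans; [now apply IH1|]. apply IH2.
    now apply (whomot_valid att_step_rev (adm_good Adm) H1).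
Qed.

Definition Z : Hcomplex H :=
  z_hcomplex X att_step_rev att_act att_act1 att_actM att_step_act linked good_z zDP_linked linked_act zDP_act zCP_act.

Definition ZtoX : hom Z X :=
  z_hom X att_step_rev att_act att_act1 att_actM att_step_act linked good_z zDP_linked linked_act zDP_act zCP_act.

Lemma zDP_yD e : zDP (yD e).
Proof. split; [apply linked_yV|]. apply (adm_DY Adm). now exists e. Qed.

Lemma zCP_yC c : zCP (yC c).
Proof. split; [apply linked_yV|]. apply (adm_CY Adm). now exists c. Qed.

(** The map on 2-cells is defined through one chosen boundary position; [zC_face] makes the choice
    immaterial. *)
Definition face_pos (F : cF Y) : cC Y :=
  proj1_sig (constructive_indefinite_description _ (face_nonempty _ F)).

Lemma face_pos_spec F : cface (face_pos F) = F.
Proof. unfold face_pos. now destruct (constructive_indefinite_description _ _). Qed.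

Definition zV (y : cV Y) : cV Z := exist linked _ (linked_yV y).
Definition zD (e : cD Y) : cD Z := exist zDP _ (zDP_yD e).
Definition zC (c : cC Y) : cC Z := exist zCP _ (zCP_yC c).
Definition zF (F : cF Y) : cF Z := @cface Z (zC (face_pos F)).

Lemma zC_face c c' : cface c = cface c' -> @cface Z (zC c) = @cface Z (zC c').
Proof.
  intro E. apply sig_eq. simpl. apply (frep_eq X att_step_rev good_z); [apply zCP_yC|].
  now apply same_face_reach.
Qed.

Definition YtoZ : hom Y Z.
Proof.
  refine (@Hom Y Z zV zD zF zC _ _ _ _ _ _ _).
  - intro e. now apply sig_eq.
  - intro e. apply sig_eq. symmetry. apply drev_yD.
  - intro c. apply zC_face. now rewrite face_pos_spec.
  - intro c. apply sig_eq. apply pdart_yC.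
  - intro c. apply sig_eq. symmetry. apply pnext_yC.
  - intro c. apply sig_eq. symmetry. apply pflip_yC.
  - intros c c' E1 E2. apply (f_face_inj f _ _ E1).
    exact (f_equal (fun p => snd (proj1_sig p)) E2).
Defined.

Lemma YtoZ_equivariant : equivariant YtoZ.
Proof.
  repeat split.
  - intros a y. apply sig_eq, yV_act.
  - intros a e. apply sig_eq, yD_act.
  - intros a F. transitivity (@cface Z (zC (aC Y a (face_pos F)))).
    + apply zC_face. now rewrite face_pos_spec, a_face, face_pos_spec.
    + transitivity (@cface Z (aC Z a (zC (face_pos F)))).
      * f_equal. apply sig_eq, yC_act.
      * apply a_face.
  - intros a c. apply sig_eq, yC_act.
Qed.

Lemma YtoZ_factors : factors YtoZ ZtoX f.
Proof.
  repeat split.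
  - intro y. apply att_over_cls.
  - intro F. transitivity (fF ZtoX (@cface Z (zC (face_pos F)))); [easy|].
    rewrite <- f_face. change (cface (fC f (face_pos F)) = fF f F).
    now rewrite f_face, face_pos_spec.
Qed.

Lemma unlift_YtoZ l : unlift X zDP (map (fD YtoZ) l) = map (fD f) l.
Proof. unfold unlift. now rewrite map_map. Qed.

Lemma z_homot (y : cV Y) (L L' : list (cD Z)) : chain (zV y) L -> chain (zV y) L' ->
  whomot att_step DP CP (yV y) (unlift X zDP L) (unlift X zDP L') -> homotopic (zV y) L L'.
Proof.
  intros HL HL' Hh. refine (z_homotopic _ _ _ _ HL HL' eq_refl eq_refl).
  apply zwhomot; [apply linked_yV| |easy].
  apply wvalid_mono with (2 := proj1 (z_chain _ _ _ _ _ _ _ _ _ _ _ _ _ _ HL)).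
  now intros e [_ He].
Qed.

Lemma YtoZ_surj : pi1_surj YtoZ.
Proof.
  intros y m Hm Em.
  destruct (z_chain _ _ _ _ _ _ _ _ _ _ _ _ _ _ Hm) as [B1 B2].
  assert (E2 : walk att_step (yV y) (unlift X zDP m) = yV y).
  { exact (eq_trans (eq_sym B2) (f_equal (@proj1_sig _ _) Em)). }
  destruct (adm_surj Adm y (unlift X zDP m)) as (l & (q & Hq & Eq & ->) & Hh); [|easy|].
  { apply wvalid_mono with (2 := B1). now intros e [_ He]. }
  exists q. split; [easy|]. split; [easy|]. apply z_homot; [|easy|].
  - now apply (chain_map YtoZ).
  - now rewrite unlift_YtoZ.
Qed.

Lemma YtoZ_closed : closed_path (map_path YtoZ (Path p0 wP)).
Proof.
  unfold closed_path; simpl. rewrite (pend_map YtoZ). apply sig_eq. simpl.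
  rewrite <- walk_yV by easy. exact (whomot_walk att_step_rev (adm_good Adm) (adm_null Adm)).
Qed.

Lemma YtoZ_null : nullhomotopic (map_path YtoZ (Path p0 wP)).
Proof.
  unfold nullhomotopic; simpl. apply (@z_homot p0 _ nil); [now apply (chain_map YtoZ)|easy|].
  rewrite unlift_YtoZ. exact (adm_null Adm).
Qed.

Lemma Z_connected : connected Y -> connected Z.
Proof.
  intros HY [u Hu] [v Hv].
  assert (Hu' := Hu). destruct Hu' as (y & l & Hl & Eu).
  assert (Hv' := Hv). destruct Hv' as (y' & l' & Hl' & Ev).
  destruct (HY y y') as (q & Hq & Eq).
  assert (G := adm_good Adm).
  assert (Hm : wvalid att_step DP u (winv l ++ map (fD f) q ++ l') /\
    walk att_step u (winv l ++ map (fD f) q ++ l') = v).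
  { rewrite !wvalid_app, !walk_app. rewrite <- Eu, (walk_winv att_step_rev G Hl).
    rewrite walk_yV, Eq by easy. split; [|easy].
    split; [now apply (wvalid_winv att_step_rev G)|]. split; [|easy].
    apply wvalid_mono with (2 := valid_yV _ _ Hq). exact (adm_DY Adm). }
  destruct Hm as [H1 H2]. 
  destruct (z_lift X att_step_rev att_act att_act1 att_actM att_step_act linked good_z zDP_linked linked_act zDP_act
    zCP_act (exist linked u Hu) _ (zvalid _ Hu H1)) as (L & HL & EL).
  exists L. split; [easy|]. apply sig_eq.
  refine (eq_trans (proj2 (z_chain _ _ _ _ _ _ _ _ _ _ _ _ _ _ HL)) _).
  now rewrite EL.
Qed.

(** * Cocompactness of [Z] *)

Section Cocompact.
Variables (LD : list (att * cD X)) (LC : list (pos X att)).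
Hypothesis LD_covers : covers X att_act isD LD DP.
Hypothesis LC_covers : forall p, CP p -> isC p \/ exists a q, In q LC /\ p = pact X att_act a q.

(** The last letter of a word linking [v] to [Y] decides: it is a dart of [Y] or a translate of a
    listed dart, and [v] is its far end. *)
Lemma linked_cases v : linked v ->
  (exists y, v = yV y) \/ exists a e, In e LD /\ v = att_act a (att_step (fst e) (snd e)).
Proof.
  intros (y & l & Hl & <-). destruct l as [|d l _] using rev_ind; [left; now exists y|].
  rewrite walk_app. apply wvalid_app in Hl as [_ [Hd _]].
  destruct (LD_covers Hd) as [[e Ee]|(a & e & He & Ee)].
  - left. exists (tgt e). simpl. rewrite <- att_step_yV. now injection Ee as -> ->.
  - right. exists a, e. split; [easy|]. simpl. rewrite <- att_step_act. now injection Ee as -> ->.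
Qed.


Lemma Z_cocompact : cocompact Y -> cocompact Z.
Proof.
  intros ((rV & HV) & (rD & HD) & (rF & HF)).
  destruct (cover_sig H att_act att_act1 att_actM linked linked_act (map (fun e => att_step (fst e) (snd e)) LD))
    as [LV' HV'].
  destruct (cover_sig H (dact X att_act) (dact1 X att_act att_act1) (dactM X att_act att_actM) zDP zDP_act LD)
    as [LD' HD'].
  destruct (cover_sig H (pact X att_act) (pact1 X att_act att_act1) (pactM X att_act att_actM) zCP zCP_act LC)
    as [LC' HC'].
  repeat split.
  - exists (map zV rV ++ LV'). intros [v Hv].
    destruct (linked_cases Hv) as [[y Ey]|(a & e & He & Ee)].
    + destruct (HV y) as (a & y1 & H1 & E1). exists a, (zV y1).
      split; [apply in_or_app; left; now apply in_map|]. apply sig_eq. simpl.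
      now rewrite Ey, E1, yV_act.
    + destruct (HV' (exist _ v Hv)) as (b & w & Hw & Ew).
      { exists a, (att_step (fst e) (snd e)). split; [|easy].
        now apply (in_map (fun e => att_step (fst e) (snd e))). }
      exists b, w. split; [apply in_or_app; now right|]. now apply sig_eq.
  - exists (map zD rD ++ LD'). intros [e He].
    destruct (LD_covers (proj2 He)) as [[e1 E1]|(a & e1 & H1 & E1)].
    + destruct (HD e1) as (a & e2 & H2 & E2). exists a, (zD e2).
      split; [apply in_or_app; left; now apply in_map|]. apply sig_eq. simpl.
      now rewrite E1, E2, yD_act.
    + destruct (HD' (exist _ e He)) as (b & w & Hw & Ew); [now exists a, e1|].
      exists b, w. split; [apply in_or_app; now right|]. now apply sig_eq.
  - exists (map zF rF ++ map (@cface Z) LC'). intro F.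
    destruct (face_nonempty Z F) as [[p Hp] <-].
    destruct (LC_covers (proj2 Hp)) as [[c Ec]|(a & q & Hq & Eq)].
    + destruct (HF (cface c)) as (a & F1 & H1 & E1). exists a, (zF F1).
      split; [apply in_or_app; left; now apply in_map|].
      transitivity (zF (cface c)).
      * transitivity (@cface Z (zC c)).
        -- f_equal. now apply sig_eq.
        -- apply zC_face. now rewrite face_pos_spec.
      * rewrite E1. apply (proj1 (proj2 (proj2 YtoZ_equivariant))).
    + destruct (HC' (exist _ p Hp)) as (b & w & Hw & Ew); [now exists a, q|].
      exists b, (@cface Z w). split; [apply in_or_app; right; now apply in_map|].
      transitivity (@cface Z (aC Z b w)); [|apply a_face]. f_equal. now apply sig_eq.
Qed.

End Cocompact.

(** * Boundary and isolated 0-cells of [Z] *)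

Section Boundary.
Hypothesis thin_old : forall e, DP e -> thin X CP e -> isD e.

Lemma bnd_or_isolated_lift (z : cV Z) : bnd_or_isolated z ->
  exists y, bnd_or_isolated y /\ z = zV y.
Proof.
  intro Hz.
  assert (He : exists e : cD Z, src e = z /\ (valence_zero e \/ valence_one e)).
  { destruct Hz as [[[(e & Es & _) Hc]|(e & Es & He)]|(e & Es & He)].
    (* A link that is a single vertex has no edges, so this case is one of valence zero. *)
    - exists e. split; [easy|]. left. intros c Ec. apply (Hc c). 
      unfold tgt. now rewrite <- cnext_src, Ec.
    - exists e. tauto.
    - exists e. tauto. }
  clear Hz. destruct He as (e & <- & He).
  assert (Ht : thin X CP (proj1_sig e)).
  { intros p q Hp Hq Ep Eq.
    assert (Hl : linked (fst (proj1_sig e))) by exact (proj1 (proj2_sig e)).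
    assert (Hp' : zCP p) by (split; [now rewrite <- Ep in Hl|easy]).
    assert (Hq' : zCP q) by (split; [now rewrite <- Eq in Hl|easy]).
    set (cp := exist zCP p Hp' : cC Z). set (cq := exist zCP q Hq' : cC Z).
    destruct (cnext_surj Z cp) as [cp' Ep']. destruct (cnext_surj Z cq) as [cq' Eq'].
    assert (Dp : cdart (cnext cp') = e) by (rewrite Ep'; now apply sig_eq).
    assert (Dq : cdart (cnext cq') = e) by (rewrite Eq'; now apply sig_eq).
    destruct He as [He|(c & _ & He)]; [now destruct (He cp')|].
    assert (E : cp = cq) by now rewrite <- Ep', <- Eq', (He _ Dp), (He _ Dq).
    exact (f_equal (@proj1_sig _ _) E). }
  destruct (thin_old (proj2 (proj2_sig e)) Ht) as [e' Ee'].
  exists (src e'). split.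
  2: { apply sig_eq. simpl. now rewrite Ee'. }
  (* Valence at most one passes back to [Y]: two corners at [e'] give positions on one thin dart of
     [Z], which coincide, and the immersion [f] separates positions with a common source. *)
  assert (Hs : forall c c', cdart (cnext c) = e' -> cdart (cnext c') = e' -> c = c').
  { intros c c' Ec Ec'. apply cnext_inj, (immersion_positions fi).
    - now rewrite Ec, Ec'.
    - assert (E : yC (cnext c) = yC (cnext c')).
      { apply Ht; [apply zCP_yC|apply zCP_yC| |]; rewrite pdart_yC, Ee'; now f_equal. }
      exact (f_equal snd E). }
  destruct (classic (exists c, cdart (cnext c) = e')) as [[c Ec]|N].
  - left. right. exists e'. split; [easy|]. exists c. split; [easy|]. intros c' Ec'.
    now apply Hs.
  - right. exists e'. split; [easy|]. intros c Ec. apply N. now exists c.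
Qed.

(** The predicate [Q] depends only on the orbit of [z], so [epsilon] selects literally the same
    0-cell of [Y] for the whole orbit. Injectivity on orbits follows because [Y -> Z] is equivariant
    and sends the selected 0-cell back into the orbit of [z]. *)
Lemma Z_boundary : orbit_card_le Z Y.
Proof.
  set (Q := fun (z : cV Z) (y : cV Y) => bnd_or_isolated y /\ orbV Z z (zV y)).
  set (g := fun z : {z : cV Z | bnd_or_isolated z} => epsilon (inhabits p0) (Q (proj1_sig z))).
  assert (Hg : forall z, Q (proj1_sig z) (g z)).
  { intro z. apply epsilon_spec. destruct (bnd_or_isolated_lift (proj2_sig z)) as (y & Hy & Ey).
    exists y. split; [easy|]. exists (gone H). now rewrite aV1, <- Ey. }
  assert (Zsym : forall z z' : cV Z, orbV Z z z' -> orbV Z z' z).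
  { intros z z' [a ->]. exists (ginv H a). now rewrite aV_inv. }
  assert (Ztrans : forall x y z : cV Z, orbV Z x y -> orbV Z y z -> orbV Z x z).
  { intros x y z [a ->] [b ->]. exists (gmul H b a). now rewrite aVM. }
  exists g. split; [intro z; apply Hg|split].
  - intros z1 z2 Hz. exists (gone H). rewrite aV1. unfold g. f_equal.
    apply functional_extensionality. intro y. apply propositional_extensionality.
    unfold Q. split; intros [Hy Ho]; (split; [easy|]); eauto.
  - intros z1 z2 [a Ha]. apply Ztrans with (zV (g z1)); [apply Hg|].
    apply Ztrans with (zV (g z2)); [|apply Zsym, Hg]. exists a. rewrite Ha.
    apply (proj1 YtoZ_equivariant).
Qed.

End Boundary.

End Attach.

Theorem theorem6p3 (H : grp) (X Y : Hcomplex H) (f : hom Y X) (P : path Y) :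
  simply_connected X ->
  equivariant f -> immersion f ->
  valid_path P -> essential P ->
  closed_path (map_path f P) -> simple_closed (map_path f P) ->
  exists (Z : Hcomplex H) (g : hom Y Z) (k : hom Z X),
    equivariant g /\ equivariant k /\ factors g k f /\
    pi1_surj g /\ immersion k /\
    closed_path (map_path g P) /\ nullhomotopic (map_path g P) /\
    (connected Y -> connected Z) /\
    (cocompact Y -> cocompact Z) /\
    orbit_card_le Z Y.
Proof.
  intros (_ & _ & SX) ef fi HP _ HC _. destruct P as [p0 wP].
  unfold valid_path in HP. unfold closed_path in HC. simpl in HP, HC.
  (* Simple connectivity of [X] contracts the closed image path; [A] lists the 2-cells used, and
     these are the ones to be attached. *)
  destruct (homotopic_finite (SX _ _ (chain_map f _ _ HP) HC)) as [A HA].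
  set (pt := yV X Y f p0 A).
  (* The starting point of the deletions: all correctly based darts, the 2-cells of [Y] and the
     attached ones. *)
  assert (Adm : admissible X (@att_over H X Y f p0 A) (@att_step H X Y f p0 A) (@att_act H X Y f p0 A)
    (@isD H X Y f p0 A) (@isC H X Y f p0 A) pt (@loops H X Y f) (pt p0) (map (fD f) wP)
    (@att_dart H X Y f p0 A) (@att_pos H X Y f p0 A)).
  { split.
    - now apply good_att.
    - intros e [e' ->]. now apply att_dart_yD.
    - intros p Hp. now left.
    - intros a e. now apply att_dart_act.
    - intros a p. now apply att_pos_act.
    - intros y m _ E. now apply att_surj.
    - now apply att_null. }
  assert (D1 : forall e, @isD H X Y f p0 A e -> isD (drev (@att_step H X Y f p0 A) e)).
  { intros e [e' ->]. exists (rev e'). apply drev_yD. }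
  assert (D2 : forall a e, @isD H X Y f p0 A e -> isD (dact X (@att_act H X Y f p0 A) a e)).
  { intros a e [e' ->]. exists (aD Y a e'). symmetry. now apply yD_act. }
  assert (C1 : forall p, @isC H X Y f p0 A p -> isC (pnext (@att_step H X Y f p0 A) p)).
  { intros p [c ->]. exists (cnext c). apply pnext_yC. }
  assert (C2 : forall p, @isC H X Y f p0 A p -> isC (pflip (@att_step H X Y f p0 A) p)).
  { intros p [c ->]. exists (cflip c). apply pflip_yC. }
  assert (C3 : forall p, @isC H X Y f p0 A p -> isD (pdart p)).
  { intros p [c ->]. exists (cdart c). apply pdart_yC. }
  assert (W1 : forall y l, loops X Y f y l -> wvalid (@att_step H X Y f p0 A) (@isD H X Y f p0 A) (pt y) l).
  { intros y l (q & Hq & _ & ->). now apply valid_yV. }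
  assert (W2 : wvalid (@att_step H X Y f p0 A) (@isD H X Y f p0 A) (pt p0) (map (fD f) wP)).
  { now apply valid_yV. }
  destruct (att_pos_finite ef p0 A) as [LC HL].
  destruct (core (@att_step_rev _ _ _ _ ef p0 A) (@att_act1 _ _ _ _ ef p0 A) (@att_actM _ _ _ _ ef p0 A)
    (@att_step_act _ _ _ _ ef p0 A) D1 D2 C1 C2 C3 W1 W2 LC Adm)
    as (DP & CP & Adm' & HD & HCP & Ht).
  { intros p Hp. destruct (HL p Hp) as [Hc|Hq]; [left; now apply C3|now right]. }
  exists (Z ef wP Adm'), (YtoZ ef wP Adm'), (ZtoX ef wP Adm').
  split; [apply YtoZ_equivariant|].
  split; [apply z_hom_equivariant; now apply att_over_act|].
  split; [apply YtoZ_factors|].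
  split; [apply YtoZ_surj|].
  split; [apply z_hom_immersion|].
  split; [now apply YtoZ_closed|].
  split; [now apply YtoZ_null|].
  split; [apply Z_connected|].
  split; [|now apply Z_boundary].
  apply Z_cocompact with (LC := LC) (1 := HD). intros p Hp. apply HL. now apply HCP.
Qed.
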